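(* Let $p\ge 5$ be prime and let $G$ be a primitive but not $2$-fold transitive permutation group of degree $3p$ on a set $\Omega$. If $G$ is of Type IV, then $p=3a^2+3a+1$ where $a$ is an integer, and the following holds. Let $\Delta_1,\Delta_2,\Delta_3$ be the three non-diagonal orbits of $G$ on $\Omega\times\Omega$ and $n_1,n_2,n_3$ the corresponding subdegrees. If two (distinct) suborbits are paired, say (with suitable numbering) $\Delta_2^*=\Delta_3$, then either (i) $a$ is even and $n_1=p-2a-1$, $n_2=n_3=p+a$; or (ii) $a$ is odd and $n_1=p+2a+1$, $n_2=n_3=p-a-1$. Otherwise all suborbits are self-paired, in which case (iii) $a$ is even and the subdegrees of $G$ are $1,\ p+2a+1,\ p-a-1,\ p-a-1$.
   Context: Let $\pi$ denote the (complex) permutation character of $G$. $G$ is of Type IV if $\pi=1_G+\chi_1+\chi_2+\chi_3$ where $\chi_1,\chi_2,\chi_3$ are distinct irreducible characters of $G$ of degrees $p$, $p$, $p-1$ respectively; then $G$ has rank $4$, i.e. exactly four orbits on $\Omega\times\Omega$, one of which is the diagonal. For an orbit $\Delta$ of $G$ on $\Omega\times\Omega$, the corresponding subdegree is $|\{\beta:(\alpha,\beta)\in\Delta\}|$ (independent of $\alpha\in\Omega$), and $\Delta^*=\{(\alpha,\beta):(\beta,\alpha)\in\Delta\}$ is the orbit paired with $\Delta$; $\Delta$ (or the corresponding suborbit, i.e. orbit of a point stabiliser) is self-paired if $\Delta^*=\Delta$. The subdegrees of $G$ are the lengths of all the suborbits, including the trivial one of length $1$. *)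

(* Defs.v *)
From HB Require Import structures.
From mathcomp Require Export all_boot all_order all_algebra.
From mathcomp Require Export all_fingroup all_solvable all_field all_character.

Set Implicit Arguments.
Unset Strict Implicit.
Unset Printing Implicit Defensive.

Import GroupScope GRing.Theory.
Local Open Scope ring_scope.

Section PermutationCharacter.
Variables (T : finType) (G : {group {perm T}}).

Fact perm_char_subproof :
  is_class_fun <<G>> [ffun g => #|'Fix_'P[g]|%:R *+ (g \in G)].
Proof.
rewrite genGid; apply: intro_class_fun => [x y Gx Gy | x /negbTE-> //].
rewrite groupJr // Gx !mulr1n.
suff -> : 'Fix_'P[(x ^ y)%g] = y @: 'Fix_'P[x]
  by rewrite (card_imset _ (@perm_inj _ y)).
apply/setP=> z; apply/afix1P/imsetP => /= [|[u /afix1P /= fixu ->]].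
  rewrite /= apermE => fixz; exists ((y^-1)%g z); last by rewrite permKV.
  by apply/afix1P; rewrite /= apermE -{2}fixz /conjg !permM permK.
by move: fixu; rewrite !apermE /conjg !permM permK => ->.
Qed.

(* The permutation character: g |-> number of points of T fixed by g. *)
Definition perm_char : 'CF(G) := Cfun 1 perm_char_subproof.

Lemma perm_charE g : g \in G -> perm_char g = #|'Fix_'P[g]|%:R.
Proof. by move=> Gg; rewrite cfunElock Gg. Qed.

Definition typeIV (p : nat) : Prop :=
  exists chi1 chi2 chi3 : 'CF(G),
    [/\ [/\ chi1 \in irr G, chi2 \in irr G & chi3 \in irr G],
        uniq [:: chi1; chi2; chi3],
        [/\ chi1 1%g = p%:R, chi2 1%g = p%:R & chi3 1%g = p.-1%:R]
      & perm_char = 1 + chi1 + chi2 + chi3].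

End PermutationCharacter.

Section Orbitals.
Variable T : finType.
Implicit Types (G : {group {perm T}}) (D : {set T * T}) (x : T).

Definition pair_aperm (u : T * T) (g : {perm T}) : T * T :=
  (aperm u.1 g, aperm u.2 g).

Fact pair_aperm1 : pair_aperm^~ 1%g =1 id.
Proof. by case=> x y; rewrite /pair_aperm !apermE !perm1. Qed.

Fact pair_apermM u : act_morph pair_aperm u.
Proof. by case: u => x y g h; rewrite /pair_aperm !apermE !permM. Qed.

Canonical pair_action := TotalAction pair_aperm1 pair_apermM.

Definition orbitals G : {set {set T * T}} :=
  orbit pair_action G @: [set: T * T].

Definition diagonal : {set T * T} := [set (x, x) | x : T].

Definition paired D : {set T * T} := [set (u.2, u.1) | u in D].

(* For an orbital of a transitive group this does not depend on x. *)
Definition subdegree D x : nat := #|[set y | (x, y) \in D]|.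

Definition suborbits G x : {set {set T}} :=
  orbit 'P 'C_G[x | 'P] @: [set: T].

(* The multiset of the lengths of all suborbits, the trivial one included. *)
Definition subdegrees G x : seq nat := [seq #|(B : {set T})| | B in suborbits G x].

End Orbitals.

(* Main.v *)
Require Import Defs.
From mathcomp Require Import zify ring.

Set Implicit Arguments.
Unset Strict Implicit.
Unset Printing Implicit Defensive.

Import GroupScope Order.TTheory GRing.Theory Num.Theory.
Local Open Scope ring_scope.

(**
  The permutation character is multiplicity free, so the orbital matrices A_i
  are simultaneously diagonal, with eigenvalues n_i, l_i, m_i, v_i of
  multiplicities 1, p, p, p-1, where n_i are the subdegrees.  The v_i are
  rational integers because the character of degree p-1 is fixed by every
  Galois automorphism.  From tr A_i = 0 the number (n_i - v_i)/p is an integer;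
  it is positive by primitivity, and the three of them add up to 3.  Hence
  n_i = p + v_i and l_i + m_i = -1 - v_i, and the numbers tr(A_i A_j) determine
  all products of the differences l_i - m_i.

  If A_2^T = A_3, the l_2 - m_2 = -(l_3 - m_3) are purely imaginary,
  p = 3 v_2^2 + 3 v_2 + 1, and two intersection numbers have difference
  -1 - v_2 and odd sum.

  If all A_i are symmetric then v_i = 2 w_i - 1 with w_i integers of sum 1;
  write p = 2 m + 1 and S = - m - 2 e2(w).  The integers a_k for which
  tr(A_1 A_2 A_3) = 3 p n_k a_k satisfy
  3 e2(a) (6 m^2 + 3 m - S) = 8 m (3 m + 1) (1 + m + 2 S)^2,
  whence 6 m^2 + 3 m - S divides S (8 S + 3) (m - 3 S - 6 S^2).  The latter
  number is too small unless it vanishes: S = 0 would make p a square, and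
  m = 3 S + 6 S^2 means that some l_i = m_i, which yields (iii).
*)

(* Turns the proof of a = b into a ring identity, given a suitable linear
   combination c = d of known equations. *)
Lemma lincomb (V : zmodType) (a b c d : V) : c = d -> a - b = c - d -> a = b.
Proof. by move=> ->; rewrite subrr; apply: subr0_eq. Qed.

(** * Square matrices indexed by the points of a finite type *)

Section Kernels.
Variable T : finType.
Implicit Types f g h : T -> T -> algC.

Lemma sum_enum_val (F : T -> algC) : \sum_(i < #|T|) F (enum_val i) = \sum_x F x.
Proof. by rewrite -(big_enum_val (A := T) F); apply: eq_bigl. Qed.

(** Matrices are indexed by ordinals; passing through a function of two points keeps all later
    computations indexed by points. *)
Definition kmx f : 'M[algC]_#|T| := \matrix_(i, j) f (enum_val i) (enum_val j).

Lemma kmxE f x y : kmx f (enum_rank x) (enum_rank y) = f x y.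
Proof. by rewrite mxE !enum_rankK. Qed.

Lemma kmx_inj f g : kmx f = kmx g -> f =2 g.
Proof. by move=> efg x y; rewrite -[LHS]kmxE efg kmxE. Qed.

Lemma eq_kmx f g : f =2 g -> kmx f = kmx g.
Proof. by move=> efg; apply/matrixP=> i j; rewrite !mxE efg. Qed.

Lemma kmxM f g : kmx f *m kmx g = kmx (fun x z => \sum_y f x y * g y z).
Proof.
apply/matrixP=> i j; rewrite !mxE -sum_enum_val.
by apply: eq_bigr => k _; rewrite !mxE.
Qed.

Lemma kmxtr f : \tr (kmx f) = \sum_x f x x.
Proof.
by rewrite -sum_enum_val; apply: eq_bigr => k _; rewrite !mxE.
Qed.

Lemma kmxZ a f : a *: kmx f = kmx (fun x y => a * f x y).
Proof. by apply/matrixP=> i j; rewrite !mxE. Qed.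

End Kernels.

(** * Isotypic projections of the permutation module *)

Section IsotypicProjections.
Variables (T : finType) (G : {group {perm T}}).
Implicit Types i j : Iirr G.

(* The kernel of the projection of the permutation module onto its isotypic
   component of index i. *)
Definition iso_ker i (x y : T) : algC :=
  'chi_i 1%g / #|G|%:R * \sum_(g in G | g x == y) 'chi_i g.

Definition iso_proj i := kmx (iso_ker i).

(** This is the generalized orthogonality relation of characters, carried over from the group
    algebra to the permutation module. *)
Lemma iso_projM i j : iso_proj i *m iso_proj j = (i == j)%:R *: iso_proj i.
Proof.
rewrite kmxM kmxZ; apply: eq_kmx => x z.
have -> : \sum_y iso_ker i x y * iso_ker j y z =
   'chi_i 1%g / #|G|%:R * ('chi_j 1%g / #|G|%:R) *
    \sum_(g in G) \sum_(k in G | k x == z) 'chi_i g * 'chi_j (g^-1 * k)%g.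
  transitivity ('chi_i 1%g / #|G|%:R * ('chi_j 1%g / #|G|%:R) *
    \sum_(g in G) \sum_(h in G | h (g x) == z) 'chi_i g * 'chi_j h).
    rewrite [X in _ = _ * X](partition_big (fun g : {perm T} => g x) predT) //=.
    rewrite mulr_sumr; apply: eq_bigr => y _; rewrite /iso_ker mulrACA.
    congr (_ * _); rewrite mulr_suml; apply: eq_bigr => g /andP[_ /eqP<-].
    by rewrite mulr_sumr.
  (* With [h = g^-1 * k] the condition on points involves [k] only, and the sum over [g] becomes a
     convolution of characters. *)
  congr (_ * _); apply: eq_bigr => g Gg; rewrite (reindex_inj (mulgI g^-1)%g) /=.
  by apply: eq_bigl => k; rewrite permM permK groupMl ?groupV.
rewrite exchange_big /= /iso_ker [in RHS]mulrCA -mulrA; congr (_ * _).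
rewrite !mulr_sumr; apply: eq_bigr => k /andP[Gk _].
have -> : \sum_(g in G) 'chi_i g * 'chi_j (g^-1 * k)%g =
          #|G|%:R * ((j == i)%:R * ('chi_j k / 'chi_j 1%g)).
  rewrite -generalized_orthogonality_relation mulVKf ?neq0CG //.
  rewrite (reindex_inj invg_inj); apply: eq_big => [g|g _]; first by rewrite groupV.
  by rewrite invgK mulrC.
rewrite eq_sym; case: eqVneq => [<-|_]; last by rewrite !(mul0r, mulr0).
by field; rewrite irr1_neq0 neq0CG.
Qed.

Lemma iso_kerV i x y : iso_ker i y x = (iso_ker i x y)^*.
Proof.
rewrite /iso_ker rmorphM /= fmorph_div /= irr1_degree !conjC_nat; congr (_ * _).
rewrite rmorph_sum (reindex_inj invg_inj) /=; apply: eq_big => [g|g _].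
  by rewrite groupV; congr (_ && _); apply/eqP/eqP => <-; rewrite ?permK ?permKV.
by rewrite -irr_inv.
Qed.

Lemma iso_ker_inv i g x y : g \in G -> iso_ker i (g x) (g y) = iso_ker i x y.
Proof.
move=> Gg; rewrite /iso_ker; congr (_ * _).
rewrite (reindex_inj (conjg_inj g)) /=; apply: eq_big => [h|h _].
  by rewrite groupJr // /conjg !permM permK (inj_eq perm_inj).
by rewrite cfunJ.
Qed.

(** For fixed [g], summing the condition [g x = x] over [x] gives the number of fixed points of
    [g]. *)
Lemma iso_proj_tr i : \tr (iso_proj i) = 'chi_i 1%g * '['chi_i, perm_char G].
Proof.
rewrite kmxtr /iso_ker -mulr_sumr cfdotE mulrA; congr (_ * _).
transitivity (\sum_(g in G) 'chi_i g * #|'Fix_'P[g]|%:R); last first.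
  by apply: eq_bigr => g Gg; rewrite perm_charE // conjC_nat.
under eq_bigr do rewrite big_mkcondr.
rewrite exchange_big /=; apply: eq_bigr => g Gg.
rewrite -big_mkcond sumr_const mulr_natr; congr (_ *+ _).
by apply: eq_card => x; rewrite [LHS]inE; apply/eqP/afix1P.
Qed.

End IsotypicProjections.

(** * Orbital matrices and their eigenvalues *)

Section OrbitalAlgebra.
Variables (T : finType) (G : {group {perm T}}).
Implicit Types (i j : Iirr G) (D E : {set T * T}).

Lemma orbitals_partition : partition (orbitals G) [set: T * T].
Proof. by apply: orbit_partition; apply/actsP=> g _ u; rewrite !inE. Qed.

(** Orbit counting on [T * T]: an element fixes a pair exactly when it fixes both points. *)
Lemma card_orbitals : #|orbitals G|%:R = '[perm_char G].
Proof.
apply: (mulIf (neq0CG G)); rewrite -natrM -Frobenius_Cauchy; last first.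
  by apply/actsP=> g _ u; rewrite !inE.
rewrite cfdotE mulrC mulVKf ?neq0CG // natr_sum; apply: eq_bigr => g Gg.
rewrite perm_charE // conjC_nat -natrM -cardsX; congr (_%:R); apply: eq_card => u.
case: u => x y; rewrite in_setI in_setT in_setX.
apply/afix1P/andP => /= [[gx gy]|]; first by split; apply/afix1P.
by case=> /afix1P /= gx /afix1P /= gy; rewrite /pair_aperm /= gx gy.
Qed.

Lemma orbital_refl u : orbit (pair_action T) G u \in orbitals G.
Proof. by apply/imsetP; exists u. Qed.

Lemma orbital_eq D u : D \in orbitals G -> u \in D -> D = orbit (pair_action T) G u.
Proof. by case/imsetP=> v _ -> /orbit_eqP->. Qed.

Lemma orbital_inv D g x y : D \in orbitals G -> g \in G ->
  ((g x, g y) \in D) = ((x, y) \in D).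
Proof.
case/imsetP=> v _ -> Gg; rewrite -[(g x, g y)]/(pair_action T (x, y) g).
by rewrite orbit_actr.
Qed.

Lemma orbital_const (f : T -> T -> algC) D u v :
  (forall g x y, g \in G -> f (g x) (g y) = f x y) ->
  D \in orbitals G -> u \in D -> v \in D -> f v.1 v.2 = f u.1 u.2.
Proof.
move=> finv OD Du; rewrite (orbital_eq OD Du) => /orbitP[g Gg <-].
exact: finv.
Qed.

Lemma orbital_card_gt0 D : D \in orbitals G -> (0 < #|D|)%N.
Proof. by case/imsetP=> u _ ->; apply/card_gt0P; exists u; apply: orbit_refl. Qed.

Lemma paired_mem D x y : ((x, y) \in paired D) = ((y, x) \in D).
Proof.
apply/imsetP/idP => [[[a b] Dab [-> ->]] // | Dyx].
by exists (y, x).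
Qed.

Lemma pairedK : involutive (@paired T).
Proof. by move=> D; apply/setP=> -[x y]; rewrite !paired_mem. Qed.

Lemma card_paired D : #|paired D| = #|D|.
Proof. by rewrite card_imset // => -[a b] [c d] [-> ->]. Qed.

Lemma paired_orbital D : D \in orbitals G -> paired D \in orbitals G.
Proof.
case/imsetP=> -[x y] _ ->; apply/imsetP; exists (y, x) => //.
apply/setP=> -[a b]; rewrite paired_mem.
by apply/orbitP/orbitP => -[g Gg [<- <-]]; exists g.
Qed.

Definition orb_ker D (x y : T) : algC := ((x, y) \in D)%:R.
Definition orb_mx D := kmx (orb_ker D).

(* The trace of orb_mx D *m iso_proj i over chi_i(1): the eigenvalue of orb_mx D
   on the i-th component when that component is irreducible. *)
Definition eigval i D : algC :=
  (\sum_(u in D) iso_ker i u.2 u.1) / 'chi_i 1%g.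

Lemma sum_orb_ker D (f : T -> T -> algC) :
  \sum_x \sum_y orb_ker D x y * f x y = \sum_(u in D) f u.1 u.2.
Proof.
rewrite pair_big /= [RHS]big_mkcond; apply: eq_bigr => -[x y] _.
by rewrite /orb_ker; case: ifP; rewrite ?mul1r ?mul0r.
Qed.

Lemma tr_orb_iso i D : \tr (orb_mx D *m iso_proj i) = 'chi_i 1%g * eigval i D.
Proof.
rewrite kmxM kmxtr mulrC divfK ?irr1_neq0 //.
exact: (sum_orb_ker D (fun x y => iso_ker i y x)).
Qed.

Lemma sum_paired D (f : T -> T -> algC) :
  \sum_(u in paired D) f u.1 u.2 = \sum_(u in D) f u.2 u.1.
Proof. by rewrite big_imset // => -[a b] [c d] _ _ [-> ->]. Qed.

Lemma eigval_paired i D : eigval i (paired D) = (eigval i D)^*.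
Proof.
rewrite /eigval (sum_paired D (fun x y => iso_ker i y x)) fmorph_div /=.
rewrite irr1_degree conjC_nat rmorph_sum; congr (_ / _).
by apply: eq_bigr => u _; exact: iso_kerV.
Qed.

Lemma tr_orb_orb D E : \tr (orb_mx D *m orb_mx E) = #|D :&: paired E|%:R.
Proof.
rewrite kmxM kmxtr (sum_orb_ker D (fun x y => orb_ker E y x)).
under eq_bigr => u _ do rewrite /orb_ker -paired_mem -surjective_pairing.
rewrite -natr_sum -sum1_card; congr (_%:R); rewrite [RHS]big_mkcond [LHS]big_mkcond.
by apply: eq_bigr => u _; rewrite !inE; case: (u \in D).
Qed.

Hypothesis mult_free :
  forall i, '['chi_i, perm_char G] = ('['chi_i, perm_char G] != 0)%:R.

Definition constituents : {set Iirr G} := [set i | '['chi_i, perm_char G] != 0].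

Lemma tr_iso_proj i : i \in constituents -> \tr (iso_proj i) = 'chi_i 1%g.
Proof. by rewrite inE iso_proj_tr => Ci; rewrite (mult_free i) Ci mulr1. Qed.

(** The norm of a multiplicity-free character is the number of its constituents. *)
Lemma rank_orbitals : #|orbitals G| = #|constituents|.
Proof.
apply/eqP; rewrite -(eqr_nat algC) card_orbitals cfdot_sum_irr.
rewrite -sum1_card natr_sum [X in _ == X]big_mkcond; apply/eqP/eq_bigr => i _.
rewrite cfdotC mult_free !conjC_nat inE.
by case: ('['chi_i, perm_char G] != 0); rewrite ?mulr0 ?mulr1.
Qed.

(** The part of an orbital matrix not accounted for by its expected spectral decomposition;
    [residual0] shows that it vanishes. *)
Definition residual D := orb_mx D - \sum_(i in constituents) eigval i D *: iso_proj i.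

(** Bessel's identity: both cross terms and the square of the projected part equal the same sum [s],
    so that one copy of [s] remains subtracted. *)
Lemma tr_residual D : D \in orbitals G ->
  \tr (residual D *m residual (paired D)) =
   #|D|%:R - \sum_(i in constituents) 'chi_i 1%g * (eigval i D * (eigval i D)^*).
Proof.
move=> OD; rewrite /residual mulmxBl !mulmxBr !raddfB /= tr_orb_orb pairedK setIid.
set s := \sum_(i in _) 'chi_i _ * _.
have E1 D1 D2 : \tr (orb_mx D1 *m \sum_(i in constituents) eigval i D2 *: iso_proj i)
   = \sum_(i in constituents) 'chi_i 1%g * (eigval i D1 * eigval i D2).
  rewrite mulmx_sumr raddf_sum; apply: eq_bigr => i _ /=.
  by rewrite -scalemxAr mxtraceZ tr_orb_iso; ring.
have E2 : \tr ((\sum_(i in constituents) eigval i D *: iso_proj i) *m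
               (\sum_(i in constituents) eigval i (paired D) *: iso_proj i)) = s.
  rewrite mulmx_suml raddf_sum; apply: eq_bigr => i Ci /=.
  rewrite mulmx_sumr raddf_sum (bigD1 i) //= big1 ?addr0 => [|j /andP[_ nji]].
    rewrite -scalemxAl -scalemxAr !mxtraceZ iso_projM eqxx scale1r tr_iso_proj //.
    by rewrite eigval_paired; ring.
  rewrite -scalemxAl -scalemxAr !mxtraceZ iso_projM eq_sym (negPf nji).
  by rewrite scale0r linear0 !mulr0.
rewrite [\tr (_ *m orb_mx _)]mxtrace_mulC !E1 E2 opprK.
have -> : \sum_(i in constituents) 'chi_i 1%g * (eigval i D * eigval i (paired D)) = s.
  by apply: eq_bigr => i _; rewrite eigval_paired.
have -> : \sum_(i in constituents) 'chi_i 1%g * (eigval i (paired D) * eigval i D) = s.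
  by apply: eq_bigr => i _; rewrite eigval_paired [_^* * _]mulrC.
by rewrite addNr addr0.
Qed.

Lemma eigval_orbital i D u : D \in orbitals G -> u \in D ->
  eigval i D = #|D|%:R * iso_ker i u.2 u.1 / 'chi_i 1%g.
Proof.
move=> OD Du; rewrite /eigval mulr_natl -sumr_const; congr (_ / _).
apply: eq_bigr => v Dv.
apply: (orbital_const (f := fun x y => iso_ker i y x)) OD Du Dv => g x y Gg.
exact: iso_ker_inv.
Qed.

Lemma sum_orbital (F : T * T -> algC) :
  \sum_(D in orbitals G) \sum_(u in D) F u = \sum_u F u.
Proof.
rewrite -(set_partition_big _ orbitals_partition) /=; apply: eq_bigl => u.
by rewrite inE.
Qed.

(* Parseval: the squared norms of the residuals, each divided by the size of its
   orbital, add up to the rank minus the number of constituents, which is 0. *)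
Lemma residual0 D : D \in orbitals G -> residual D = 0.
Proof.
move=> OD; pose r E := \tr (residual E *m residual (paired E)).
have resE E : residual E = kmx (fun x y => orb_ker E x y -
    \sum_(i in constituents) eigval i E * iso_ker i x y).
  apply/matrixP=> a b; rewrite !mxE summxE; congr (_ - _).
  by apply: eq_bigr => i _; rewrite !mxE.
pose s E x y := orb_ker E x y - \sum_(i in constituents) eigval i E * iso_ker i x y.
have sV E x y : s (paired E) y x = (s E x y)^*.
  rewrite /s /orb_ker paired_mem rmorphB /= conjC_nat rmorph_sum; congr (_ - _).
  by apply: eq_bigr => i _; rewrite rmorphM eigval_paired iso_kerV.
have rE E : r E = \sum_x \sum_y s E x y * (s E x y)^*.
  rewrite /r !resE kmxM kmxtr; apply: eq_bigr => x _; apply: eq_bigr => y _.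
  by rewrite -sV.
have s_ge0 E x y : 0 <= s E x y * (s E x y)^* by apply: mul_conjC_ge0.
have r_ge0 E : 0 <= r E by rewrite rE; do 2!apply: sumr_ge0 => ? _.
have cD0 E : E \in orbitals G -> #|E|%:R != 0 :> algC.
  by move=> OE; rewrite pnatr_eq0 -lt0n orbital_card_gt0.
have sum_r : \sum_(E in orbitals G) r E / #|E|%:R = 0.
  transitivity (\sum_(E in orbitals G) (1 - \sum_(i in constituents)
      (\sum_(u in E) iso_ker i u.2 u.1 * iso_ker i u.1 u.2) / 'chi_i 1%g)).
    apply: eq_bigr => E OE; rewrite /r tr_residual // mulrBl divff ?cD0 //.
    congr (_ - _); rewrite mulr_suml; apply: eq_bigr => i _.
    (* [E] is a single orbit and the kernels are invariant, so a sum over [E] is [|E|] times the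
       value at one pair [u]. *)
    have /card_gt0P[u Eu] := orbital_card_gt0 OE.
    have -> : \sum_(v in E) iso_ker i v.2 v.1 * iso_ker i v.1 v.2 =
              #|E|%:R * (iso_ker i u.2 u.1 * iso_ker i u.1 u.2).
      rewrite mulr_natl -sumr_const; apply: eq_bigr => v Ev.
      apply: (orbital_const (f := fun x y => iso_ker i y x * iso_ker i x y)) OE Eu Ev.
      by move=> g x y Gg; rewrite !iso_ker_inv.
    rewrite -eigval_paired (eigval_orbital _ OE Eu).
    have OE' : paired E \in orbitals G by apply: paired_orbital.
    have Eu' : (u.2, u.1) \in paired E by rewrite paired_mem -surjective_pairing.
    rewrite (eigval_orbital _ OE' Eu') card_paired /=.
    by field; rewrite irr1_neq0 cD0.
  rewrite sumrB sumr_const rank_orbitals exchange_big /=; apply/eqP; rewrite subr_eq0.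
  apply/eqP; rewrite -sumr_const; apply: eq_bigr => i Ci.
  (* Over all orbitals the products of entries add up to the trace of the idempotent [iso_proj i],
     so each constituent contributes 1. *)
  rewrite -mulr_suml sum_orbital -(divff (irr1_neq0 i)); congr (_ / _).
  rewrite -tr_iso_proj // -[in LHS](scale1r (iso_proj i)).
  have -> : 1 = (i == i)%:R :> algC by rewrite eqxx.
  rewrite -iso_projM kmxM kmxtr pair_big; apply: eq_bigr => u _ /=.
  by rewrite mulrC.
have /eqP rD0 : r D == 0.
  move/eqP: sum_r; rewrite psumr_eq0 => [/allP/(_ D)|E _]; last first.
    by rewrite divr_ge0 ?ler0n.
  rewrite mem_index_enum OD => /(_ isT) /=.
  by rewrite mulf_eq0 invr_eq0 (negPf (cD0 _ OD)) orbF.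
rewrite resE; apply/matrixP=> a b; rewrite !mxE; apply/eqP.
move/eqP: rD0; rewrite rE psumr_eq0 => [|x _]; last exact: sumr_ge0.
move/allP/(_ (enum_val a) (mem_index_enum _)).
rewrite /= psumr_eq0 // => /allP/(_ (enum_val b) (mem_index_enum _)) /=.
by rewrite mul_conjC_eq0.
Qed.

End OrbitalAlgebra.

(** * Spectral decomposition, intersection numbers and bounds for eigenvalues *)

Section Eigenvalues.
Variables (T : finType) (G : {group {perm T}}).
Implicit Types (i j : Iirr G) (D E F : {set T * T}).

Hypothesis mult_free :
  forall i, '['chi_i, perm_char G] = ('['chi_i, perm_char G] != 0)%:R.
Local Notation C := (constituents G).

Lemma orb_mx_spectral D : D \in orbitals G ->
  orb_mx D = \sum_(i in C) eigval i D *: iso_proj i.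
Proof. by move/(residual0 mult_free)/eqP; rewrite subr_eq0 => /eqP. Qed.

Lemma orb_mxM_spectral (A : 'M_#|T|) (a : Iirr G -> algC) D : D \in orbitals G ->
  A = \sum_(i in C) a i *: iso_proj i ->
  orb_mx D *m A = \sum_(i in C) (eigval i D * a i) *: iso_proj i.
Proof.
move=> OD ->; rewrite orb_mx_spectral // mulmx_suml; apply: eq_bigr => i Ci.
rewrite mulmx_sumr (bigD1 i) //= big1 ?addr0 => [|j /andP[_ nji]].
  by rewrite -scalemxAl -scalemxAr iso_projM eqxx scale1r scalerA.
by rewrite -scalemxAl -scalemxAr iso_projM eq_sym (negPf nji) scale0r !scaler0.
Qed.

Lemma tr_spectral (a : Iirr G -> algC) :
  \tr (\sum_(i in C) a i *: iso_proj i) = \sum_(i in C) 'chi_i 1%g * a i.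
Proof.
rewrite raddf_sum; apply: eq_bigr => i Ci /=.
by rewrite mxtraceZ tr_iso_proj // mulrC.
Qed.

Lemma eigval_tr1 D : D \in orbitals G ->
  \sum_(i in C) 'chi_i 1%g * eigval i D = #|[set x | (x, x) \in D]|%:R.
Proof.
move=> OD; rewrite -tr_spectral -orb_mx_spectral // kmxtr -sum1_card natr_sum.
by rewrite [RHS]big_mkcond; apply: eq_bigr => x _; rewrite inE /orb_ker; case: ifP.
Qed.

Lemma eigval_tr2 D E : D \in orbitals G -> E \in orbitals G ->
  \sum_(i in C) 'chi_i 1%g * (eigval i D * eigval i E) = #|D :&: paired E|%:R.
Proof.
move=> OD OE; rewrite -tr_spectral -(orb_mxM_spectral OD (orb_mx_spectral OE)).
exact: tr_orb_orb.
Qed.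

(** The witness is an intersection number: it counts the two-step paths from [u.2] to [u.1] through
    [E] and then [F], and by invariance it is the same for all [u] in [D]. *)
Lemma eigval_tr3 D E F : D \in orbitals G -> E \in orbitals G -> F \in orbitals G ->
  exists c : nat,
    \sum_(i in C) 'chi_i 1%g * (eigval i D * (eigval i E * eigval i F)) = (#|D| * c)%:R.
Proof.
move=> OD OE OF; have /card_gt0P[u Du] := orbital_card_gt0 OD.
exists #|[set z | ((u.2, z) \in E) && ((z, u.1) \in F)]|.
rewrite -tr_spectral.
rewrite -(orb_mxM_spectral OD (orb_mxM_spectral OE (orb_mx_spectral OF))).
rewrite kmxM kmxM kmxtr.
rewrite (sum_orb_ker D (fun x y => \sum_z orb_ker E y z * orb_ker F z x)).
have -> : \sum_(v in D) \sum_z orb_ker E v.2 z * orb_ker F z v.1 =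
   \sum_(v in D) \sum_z orb_ker E u.2 z * orb_ker F z u.1.
  apply: eq_bigr => v Dv.
  apply: (orbital_const (f := fun x y => \sum_z orb_ker E y z * orb_ker F z x)) OD Du Dv.
  move=> g x y Gg; rewrite (reindex_inj (@perm_inj _ g)) /=.
  by apply: eq_bigr => z _; rewrite /orb_ker (orbital_inv _ _ OE Gg) (orbital_inv _ _ OF Gg).
rewrite sumr_const natrM mulr_natl; congr (_ *+ _).
rewrite -sum1_card natr_sum [RHS]big_mkcond; apply: eq_bigr => z _.
by rewrite inE /orb_ker; do 2!case: (_ \in _); rewrite ?mulr0 ?mulr1.
Qed.

Lemma iso_proj_neq0 i : i \in C -> iso_proj i != 0.
Proof.
move=> Ci; apply: contraTneq (irr1_neq0 i) => F0.
by rewrite -tr_iso_proj // F0 mxtrace0 eqxx.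
Qed.

(** A nonzero vector in the row space of [iso_proj i] is an eigenvector, and the characteristic
    polynomial of an integer matrix is monic and integral. *)
Lemma eigval_Aint i D : i \in C -> D \in orbitals G -> eigval i D \in Aint.
Proof.
move=> Ci OD; pose B : 'M[int]_#|T| := \matrix_(a, b) ((enum_val a, enum_val b) \in D)%:R.
have AB : orb_mx D = map_mx intr B.
  by apply/matrixP=> a b; rewrite !mxE rmorph_nat.
have /rowV0Pn[v /submxP[w ->] nz_v] := iso_proj_neq0 Ci.
have FA : iso_proj i *m orb_mx D = eigval i D *: iso_proj i.
  rewrite orb_mx_spectral // mulmx_sumr (bigD1 i) //= big1 ?addr0 => [|j /andP[_ nji]].
    by rewrite -scalemxAr iso_projM eqxx scale1r.
  by rewrite -scalemxAr iso_projM eq_sym (negPf nji) scale0r scaler0.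
have : eigenvalue (orb_mx D) (eigval i D).
  by apply/eigenvalueP; exists (w *m iso_proj i); rewrite // -mulmxA FA scalemxAr.
rewrite eigenvalue_root_char AB -map_char_poly => rt.
apply: root_monic_Aint rt _ _; first exact/monic_map/char_poly_monic.
by apply/polyOverP=> k; rewrite coef_map /= rpred_int.
Qed.

Hypothesis trG : [transitive G, on [set: T] | 'P].

Lemma transP x y : exists2 g, g \in G & y = g x.
Proof. by apply: (atransP2 trG); rewrite inE. Qed.

(** By transitivity all entries in a row agree, and each row sums to 1. *)
Lemma iso_ker_triv x y : iso_ker (0 : Iirr G) x y = #|T|%:R^-1.
Proof.
have c z : iso_ker (0 : Iirr G) x z = iso_ker (0 : Iirr G) x y.
  have [h Gh ->] := transP y z; rewrite /iso_ker irr0; congr (_ * _).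
  rewrite (reindex_inj (mulIg h)); apply: eq_big => [g | g /andP[Gg _]].
    by rewrite groupMr // permM (inj_eq perm_inj).
  by rewrite !cfun1E; move: Gg; rewrite groupMr // => ->.
have nzT : #|T|%:R != 0 :> algC by rewrite pnatr_eq0 -lt0n; apply/card_gt0P; exists x.
apply: (mulfI nzT); rewrite divff // mulr_natl -sumr_const.
transitivity (\sum_z iso_ker (0 : Iirr G) x z); first by apply: eq_bigr => z _; rewrite c.
rewrite /iso_ker -mulr_sumr.
have -> : \sum_z \sum_(g in G | g x == z) 'chi[G]_0 g = \sum_(g in G) 'chi[G]_0 g.
  by rewrite [RHS](partition_big (fun g : {perm T} => g x) predT).
rewrite irr0 cfun11 mul1r; under eq_bigr => g Gg do rewrite cfun1E Gg.
by rewrite sumr_const mulVf ?neq0CG.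
Qed.

Lemma subdegree_card D x : D \in orbitals G -> #|D| = (#|T| * subdegree D x)%N.
Proof.
move=> OD; transitivity (\sum_y \sum_z ((y, z) \in D))%N.
  rewrite pair_big -sum1_card [LHS]big_mkcond; apply: eq_bigr => -[y z] _ /=.
  by case: (_ \in D).
rewrite -sum_nat_const; apply: eq_bigr => y _.
transitivity #|[set z | (y, z) \in D]|.
  rewrite -sum1_card [RHS]big_mkcond; apply: eq_bigr => z _.
  by rewrite inE; case: (_ \in D).
have [g Gg ->] := transP x y; rewrite -[RHS](card_imset _ (@perm_inj _ g)).
apply: eq_card => z; rewrite [LHS]inE; apply/idP/imsetP => [|[w]].
  by move=> Dz; exists ((g^-1)%g z); rewrite ?permKV // inE -(orbital_inv _ _ OD Gg) permKV.
by rewrite inE => Dw ->; rewrite (orbital_inv _ _ OD Gg).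
Qed.

Lemma eigval_triv D x : D \in orbitals G -> eigval (0 : Iirr G) D = (subdegree D x)%:R.
Proof.
move=> OD; rewrite /eigval irr0 cfun11 divr1; under eq_bigr do rewrite iso_ker_triv.
rewrite sumr_const (subdegree_card x OD) -[_ *+ (_ * _)]mulr_natl natrM mulrAC mulfV ?mul1r //.
by rewrite pnatr_eq0 -lt0n; apply/card_gt0P; exists x.
Qed.

(** Orthogonality to [iso_proj 0], whose entries are all equal and nonzero. *)
Lemma sum_iso_ker i x : i != 0 -> \sum_y iso_ker i x y = 0.
Proof.
move=> nz_i; have := iso_projM i 0; rewrite (negPf nz_i) scale0r kmxM => /matrixP E.
have := E (enum_rank x) (enum_rank x); rewrite !mxE !enum_rankK.
under eq_bigr do rewrite iso_ker_triv; rewrite -mulr_suml => /eqP.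
rewrite mulf_eq0 invr_eq0 pnatr_eq0 => /orP[/eqP // | /eqP T0].
by have := max_card (pred1 x); rewrite card1 T0.
Qed.

(** The orbital matrices add up to the all-one matrix, which kills every nontrivial component. *)
Lemma sum_eigval i : i != 0 -> \sum_(D in orbitals G) eigval i D = 0.
Proof.
move=> nz_i; rewrite -mulr_suml (sum_orbital G (fun u => iso_ker i u.2 u.1)).
rewrite -(pair_bigA _ (fun x y => iso_ker i y x)) exchange_big big1 ?mul0r //= => y _.
exact: sum_iso_ker.
Qed.

Lemma diagonal_orbital x : diagonal T = orbit (pair_action T) G (x, x).
Proof.
apply/setP=> -[y z]; apply/imsetP/orbitP => [[w _ [-> ->]]|[g Gg [<- <-]]].
  by have [g Gg ->] := transP x w; exists g.
by exists (g x).
Qed.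

Lemma diagonalE x y : ((x, y) \in diagonal T) = (x == y).
Proof. by apply/imsetP/eqP => [[z _ [-> ->]] | ->]; last by exists y. Qed.

Lemma eigval_diag i : i \in C -> eigval i (diagonal T) = 1.
Proof.
move=> Ci; rewrite /eigval big_imset /=; last by move=> a b _ _ [].
have := tr_iso_proj mult_free Ci; rewrite kmxtr => ->.
by rewrite divff ?irr1_neq0.
Qed.

Lemma iso_ker_diag i x : i \in C -> iso_ker i x x = 'chi_i 1%g / #|T|%:R.
Proof.
move=> Ci; have nzT : #|T|%:R != 0 :> algC.
  by rewrite pnatr_eq0 -lt0n; apply/card_gt0P; exists x.
apply: (mulIf nzT); rewrite divfK // -tr_iso_proj // kmxtr mulr_natr -sumr_const.
by apply: eq_bigr => y _; have [g Gg ->] := transP x y; rewrite iso_ker_inv.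
Qed.

(** In a Hermitian idempotent the scalar products of columns are again entries; this is the squared
    distance of two columns. *)
Lemma iso_ker_sqr i x z :
  \sum_y (iso_ker i y x - iso_ker i y z) * (iso_ker i y x - iso_ker i y z)^* =
  iso_ker i x x + iso_ker i z z - iso_ker i x z - iso_ker i z x.
Proof.
have sq a b : iso_ker i a b = \sum_y iso_ker i a y * iso_ker i y b.
  have := iso_projM i i; rewrite eqxx scale1r kmxM => /kmx_inj E; by rewrite E.
rewrite 4!(sq x, sq z) -big_split -!sumrB /=; apply: eq_bigr => y _.
by rewrite rmorphB /= -!iso_kerV; ring.
Qed.

(** Writes the gap between the subdegree and the real part of the eigenvalue as a sum of squared
    moduli, which shows when it vanishes. *)
Lemma eigval_diff i D x : i \in C -> D \in orbitals G ->
  \sum_(u in D) \sum_y (iso_ker i y u.1 - iso_ker i y u.2) *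
                       (iso_ker i y u.1 - iso_ker i y u.2)^* =
  'chi_i 1%g * ((subdegree D x)%:R - eigval i D +
                ((subdegree D x)%:R - (eigval i D)^*)).
Proof.
move=> Ci OD; under eq_bigr => u _ do rewrite iso_ker_sqr !iso_ker_diag //.
have nzT : #|T|%:R != 0 :> algC.
  by rewrite pnatr_eq0 -lt0n; apply/card_gt0P; exists x.
rewrite !sumrB sumr_const (subdegree_card x OD) -[_ *+ (_ * _)]mulr_natl natrM.
rewrite -eigval_paired /eigval (sum_paired D (fun x y => iso_ker i y x)).
by field; rewrite irr1_neq0.
Qed.

(** Were the gap in [eigval_diff] zero, the columns at both points of a pair in [D] would agree. As
    point stabilisers are maximal, either [D] is diagonal or all columns are equal, against the
    vanishing row sums. *)
Lemma eigval_lt i D x : [primitive G, on [set: T] | 'P] ->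
  i \in C -> i != 0 -> D \in orbitals G -> D != diagonal T ->
  eigval i D \is Num.real -> eigval i D < (subdegree D x)%:R.
Proof.
move=> primG Ci nz_i OD ntD Rev.
have chi_gt0 := irr1_gt0 i.
have sq_ge0 (a : algC) : 0 <= a * a^* by apply: mul_conjC_ge0.
have := eigval_diff x Ci OD; rewrite (CrealP Rev).
set q := \sum_(u in D) _ => Eq.
have q_ge0 : 0 <= q by do 2!apply: sumr_ge0 => ? _.
rewrite -subr_gt0 lt_def; apply/andP; split; last first.
  move: q_ge0; rewrite Eq -mulr2n pmulr_rge0 //.
  by rewrite pmulrn_lge0.
apply: contraTneq ntD => d0.
have /card_gt0P[[a b] Dab] := orbital_card_gt0 OD.
have col : forall y, iso_ker i y a = iso_ker i y b.
  move=> y; apply/eqP; rewrite -subr_eq0 -mul_conjC_eq0.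
  move/eqP: Eq; rewrite d0 addr0 mulr0 psumr_eq0 => [|u _]; last exact: sumr_ge0.
  move/allP/(_ (a, b) (mem_index_enum _)); rewrite Dab /= psumr_eq0 //.
  by move/allP/(_ y (mem_index_enum _)).
(* By primitivity, the stabiliser of a column of iso_ker i is G or fixes a. *)
have grH : group_set [set g in G | [forall y, iso_ker i y (g a) == iso_ker i y a]].
  apply/group_setP; split=> [|g h].
    by rewrite inE group1 perm1; apply/forallP.
  rewrite !inE => /andP[Gg /forallP Hg] /andP[Gh /forallP Hh].
  rewrite groupM //; apply/forallP=> y; rewrite permM.
  rewrite -{1}(permKV h y) iso_ker_inv // (eqP (Hg _)) -(iso_ker_inv _ _ _ Gh).
  by rewrite permKV.
move: primG; rewrite (trans_prim_astab (in_setT a)) // => /maximal_eqP[_ maxH].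
have sub1 : 'C_G[a | 'P] \subset Group grH.
  apply/subsetP=> g /setIP[Gg /astab1P ga]; rewrite inE Gg.
  by rewrite /= apermE in ga; apply/forallP=> y; rewrite ga.
have sub2 : Group grH \subset G by apply/subsetP=> g; rewrite inE => /andP[].
have [g Gg Db] := transP a b.
have Hg : g \in Group grH by rewrite inE Gg; apply/forallP=> y; rewrite -Db col.
case: (maxH _ sub1 sub2) => eqH.
  move: Hg; rewrite eqH => /setIP[_ /astab1P]; rewrite /= apermE -Db => ba.
  by rewrite (orbital_eq OD Dab) ba -diagonal_orbital eqxx.
have ca y z : iso_ker i y z = iso_ker i y a.
  have [h Gh ->] := transP a z; move: Gh; rewrite -eqH inE => /andP[_ /forallP/(_ y)/eqP//].
have := sum_iso_ker a nz_i; under eq_bigr do rewrite ca.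
rewrite sumr_const iso_ker_diag // -[_ / _ *+ _]mulr_natr divfK.
  by move/eqP; rewrite (negPf (irr1_neq0 i)).
by rewrite pnatr_eq0 -lt0n; apply/card_gt0P; exists a.
Qed.

End Eigenvalues.

(** The value lies in a number field that is Galois over the rationals and whose automorphisms
    extend to [algC]; being fixed by all of them, it is rational. *)
Lemma aut_fixed_Crat (gT : finGroupType) (G : {group gT}) (chi : 'CF(G)) x :
  chi \is a character -> (forall u : {rmorphism algC -> algC}, cfAut u chi = chi) ->
  chi x \in Crat.
Proof.
move=> Nchi fix_chi; have [Gx | /cfun0->] := boolP (x \in G); last exact: rpred0.
have [Qn galQn [QnC gQnC [_ _ Qn_g]]] := group_num_field_exists <[x]>.
have [a Da] := Qn_g _ G _ Nchi x (dvdnn _).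
have : a \in fixedField 'Gal({:Qn} / 1).
  apply/fixedFieldP; first exact: memvf.
  move=> nu Gnu; apply: (fmorph_inj QnC); case: (gQnC nu) => u Du.
  by rewrite Du Da -[in RHS](fix_chi u) cfunE.
rewrite (galois_fixedField galQn) => /vlineP[c Dc].
by rewrite -Da Dc alg_num_field fmorph_rat rpred_rat.
Qed.

(** * Eigenvalues for a group of type IV *)

Section TypeIV.
Variables (p : nat) (T : finType) (G : {group {perm T}}).
Hypotheses (p_ge5 : (5 <= p)%N) (IV : typeIV G p).

Lemma typeIV_constt : exists i1 i2 i3 : Iirr G,
  [/\ forall i, '['chi_i, perm_char G] = (i \in [set 0; i1; i2; i3])%:R,
      uniq [:: 0; i1; i2; i3],
      [/\ 'chi_i1 1%g = p%:R, 'chi_i2 1%g = p%:R & 'chi_i3 1%g = p.-1%:R]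
    & forall x, 'chi_i3 x \in Crat].
Proof.
have [_ [_ [_ [[/irrP[i1 ->] /irrP[i2 ->] /irrP[i3 ->]] Uchi [d1 d2 d3] Dpi]]]] := IV.
have degD i j n : 'chi[G]_i 1%g = n%:R -> 'chi[G]_j 1%g != n%:R -> i != j.
  by move=> <-; apply: contraNneq => ->.
have nz (i : Iirr G) n : (1 < n)%N -> 'chi_i 1%g = n%:R -> i != 0.
  by move=> n_gt1 di; apply: (degD _ _ _ di); rewrite irr0 cfun11 (eqr_nat _ 1); lia.
have nz1 := nz i1 p ltac:(lia) d1; have nz2 := nz i2 p ltac:(lia) d2.
have nz3 := nz i3 p.-1 ltac:(lia) d3.
have n31 : i3 != i1 by apply: (degD _ _ _ d3); rewrite d1 eqr_nat; lia.
have n32 : i3 != i2 by apply: (degD _ _ _ d3); rewrite d2 eqr_nat; lia.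
have n12 : i1 != i2 by apply: contraTneq Uchi => ->; rewrite /= !inE eqxx.
have Ui : uniq [:: 0; i1; i2; i3].
  rewrite /= !inE ![0 == _]eq_sym ![_ == i3]eq_sym.
  by rewrite !negb_or nz1 nz2 nz3 n31 n32 n12.
have mult i : '['chi_i, perm_char G] = (i \in [set 0; i1; i2; i3])%:R.
  rewrite Dpi -irr0 !cfdotDr !cfdot_irr !inE.
  move: Ui; rewrite /= !inE !negb_or.
  case/and4P=> /and3P[z1 z2 z3] /andP[z4 z5] z6 _.
  have [->|_] := eqVneq i 0; first by rewrite (negPf z1) (negPf z2) (negPf z3) !addr0.
  have [->|_] := eqVneq i i1; first by rewrite (negPf z4) (negPf z5) !addr0 add0r.
  have [->|_] := eqVneq i i2; first by rewrite (negPf z6) !addr0 !add0r.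
  by rewrite !add0r.
exists i1, i2, i3; split => // x; apply: aut_fixed_Crat; first exact: irr_char.
(* The permutation character is rational, so a Galois conjugate of ['chi_i3] is again a constituent,
   and no other constituent has degree [p - 1]. *)
move=> u; rewrite -aut_IirrE; congr 'chi_(_).
have pi_u : cfAut u (perm_char G) = perm_char G.
  apply/cfun_inP=> g Gg; rewrite cfunE perm_charE //; exact: rmorph_nat.
have : '['chi_(aut_Iirr u i3), perm_char G] = 1.
  by rewrite cfdotC aut_IirrE -pi_u cfdot_aut_irr cfdotC mult !inE eqxx !orbT !rmorph1.
have du : 'chi_(aut_Iirr u i3) 1%g = p.-1%:R by rewrite aut_IirrE cfunE d3 rmorph_nat.
rewrite mult; case: (boolP (_ \in _)) => [|_ /eqP]; last by rewrite eq_sym oner_eq0.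
rewrite !inE -!orbA => /or4P[] /eqP e; rewrite e in du * => // _; exfalso.
- by move/eqP: du; rewrite irr0 cfun11 (eqr_nat _ 1); lia.
- by move/eqP: du; rewrite d1 eqr_nat; lia.
by move/eqP: du; rewrite d2 eqr_nat; lia.
Qed.
End TypeIV.

(* The traces of products of two and of three orbital matrices with the given
   eigenvalues, of multiplicities 1, p, p, p - 1. *)
Definition tr2 (p : nat) (l l' m m' : algC) (v v' : int) : algC :=
  ((p%:Z + v) * (p%:Z + v'))%:~R + p%:R * (l * l' + m * m') +
  ((p%:Z - 1) * (v * v'))%:~R.

Definition tr3 (p : nat) (l l' l'' m m' m'' : algC) (v v' v'' : int) : algC :=
  ((p%:Z + v) * ((p%:Z + v') * (p%:Z + v'')))%:~R +
  p%:R * (l * (l' * l'') + m * (m' * m'')) +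
  ((p%:Z - 1) * (v * (v' * v'')))%:~R.

(** * Integrality of the eigenvalues and their relation to the subdegrees *)

Section Spectrum.
Variables (p : nat) (T : finType) (G : {group {perm T}}).
Hypotheses (p_ge5 : (5 <= p)%N) (cardT : #|T| = (3 * p)%N).
Hypotheses (primG : [primitive G, on [set: T] | 'P]) (IV : typeIV G p).

Let p_gt0 : (0 < p)%N.
Proof. exact: leq_trans p_ge5. Qed.

Let trG : [transitive G, on [set: T] | 'P].
Proof. by case/andP: primG. Qed.

Lemma orbital_eqE (D E : {set T * T}) u :
  D \in orbitals G -> E \in orbitals G -> u \in D -> u \in E -> D = E.
Proof. by move=> OD OE Du Eu; rewrite (orbital_eq OD Du) (orbital_eq OE Eu). Qed.

Lemma diagonal_in_orbitals (x : T) : diagonal T \in orbitals G.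
Proof. by rewrite (diagonal_orbital trG x) orbital_refl. Qed.

Lemma sum_subdegree x : (\sum_(D in orbitals G) subdegree D x)%N = #|T|.
Proof.
have T_gt0 : (0 < #|T|)%N by rewrite cardT muln_gt0.
apply/eqP; rewrite -(eqn_pmul2l T_gt0) big_distrr /= -card_prod -[#|{: _ * _}|]cardsT.
rewrite (card_partition (orbitals_partition G)); apply/eqP/eq_bigr => D OD.
by rewrite (subdegree_card trG x OD).
Qed.

Lemma subdegree_diagonal x : subdegree (diagonal T) x = 1%N.
Proof.
rewrite /subdegree -(card1 x); apply: eq_card => y.
by rewrite !inE diagonalE eq_sym.
Qed.

Lemma typeIV_rank : #|orbitals G| = 4%N.
Proof.
have [i1 [i2 [i3 [mult Ui _ _]]]] := typeIV_constt p_ge5 IV.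
rewrite rank_orbitals => [|i]; last by rewrite mult; case: (_ \in _); rewrite ?eqxx ?oner_eq0.
rewrite -[4%N]/(size [:: 0; i1; i2; i3]) -(card_uniqP Ui); apply: eq_card => i.
by rewrite !inE mult !inE -!orbA; case: (_ || _); rewrite ?eqxx ?oner_eq0.
Qed.

Definition nontrivial_orbital D := (D \in orbitals G) && (D != diagonal T).

Lemma sum_nontrivial (F : {set T * T} -> algC) (x : T) :
  \sum_(D in orbitals G) F D = F (diagonal T) + \sum_(D | nontrivial_orbital D) F D.
Proof. by rewrite (bigD1 (diagonal T)) //; apply: diagonal_in_orbitals x. Qed.

(** Collects what the arithmetic needs, freed from characters: [l], [m], [v] are the eigenvalues on
    the constituents of degrees [p], [p], [p - 1]. *)
Lemma spectrum (x : T) : exists (l m : {set T * T} -> algC) (v : {set T * T} -> int),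
  [/\ forall D, nontrivial_orbital D ->
       [/\ (subdegree D x)%:Z = p%:Z + v D, l D + m D = - 1 - (v D)%:~R,
           l D \in Aint & m D \in Aint],
      forall D, nontrivial_orbital D ->
       [/\ l (paired D) = (l D)^*, m (paired D) = (m D)^* & v (paired D) = v D],
      [/\ \sum_(D | nontrivial_orbital D) l D = - 1,
          \sum_(D | nontrivial_orbital D) m D = - 1 &
          \sum_(D | nontrivial_orbital D) v D = - 1],
      forall D E, nontrivial_orbital D -> nontrivial_orbital E ->
       tr2 p (l D) (l E) (m D) (m E) (v D) (v E) =
       ((3 * p%:Z * (p%:Z + v D)) *+ (E == paired D))%:~R
    & forall D E F, nontrivial_orbital D -> nontrivial_orbital E -> nontrivial_orbital F ->
       exists c : int,
       tr3 p (l D) (l E) (l F) (m D) (m E) (m F) (v D) (v E) (v F) =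
       (3 * p%:Z * (p%:Z + v D) * c)%:~R].
Proof.
have [i1 [i2 [i3 [mult Ui [d1 d2 d3] Qi3]]]] := typeIV_constt p_ge5 IV.
have mult_free i : '['chi_i, perm_char G] = ('['chi_i, perm_char G] != 0)%:R.
  by rewrite mult; case: (_ \in _); rewrite ?eqxx ?oner_eq0.
have DC : constituents G = [set 0; i1; i2; i3].
  by apply/setP=> i; rewrite inE mult; case: (_ \in _); rewrite ?eqxx ?oner_eq0.
have sumC (F : Iirr G -> algC) : \sum_(i in constituents G) 'chi_i 1%g * F i =
    F 0 + p%:R * F i1 + p%:R * F i2 + (p%:Z - 1)%:~R * F i3.
  have -> : \sum_(i in constituents G) 'chi_i 1%g * F i =
            \sum_(i <- [:: 0; i1; i2; i3]) 'chi_i 1%g * F i.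
    by rewrite [RHS]big_uniq //=; apply: eq_bigl => i; rewrite DC !inE -!orbA.
  rewrite !big_cons big_nil addr0 irr0 cfun11 mul1r d1 d2 d3 !addrA.
  by congr (_ + _ * _); rewrite -subn1 natrB ?rmorphB.
have [C1 C2 C3] : [/\ i1 \in constituents G, i2 \in constituents G
    & i3 \in constituents G].
  by rewrite DC !inE !eqxx !orbT.
move: Ui; rewrite /= !inE !negb_or => /and4P[/and3P[z1 z2 z3] _ _ _].
rewrite eq_sym in z1; rewrite eq_sym in z2; rewrite eq_sym in z3.
have p_neq0 : p%:R != 0 :> algC by rewrite pnatr_eq0 -lt0n.
have evQ D : eigval i3 D \in Crat.
  rewrite /eigval d3 rpred_div ?rpred_nat // rpred_sum // => u _.
  by rewrite /iso_ker d3 rpredM ?rpred_div ?rpred_nat // rpred_sum.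
have nontrP D : nontrivial_orbital D -> D \in orbitals G by case/andP.
have pairedP D : nontrivial_orbital D -> nontrivial_orbital (paired D).
  case/andP=> OD ntD; rewrite /nontrivial_orbital paired_orbital //.
  rewrite -(inj_eq (can_inj (@pairedK T))) pairedK; apply: contra ntD => /eqP->.
  by apply/eqP/setP=> -[a b]; rewrite paired_mem !diagonalE eq_sym.
(* A rational algebraic integer is an integer, so on orbitals the floor rounds nothing away. *)
pose v D := Num.floor (eigval i3 D).
have vE D : D \in orbitals G -> eigval i3 D = (v D)%:~R.
  by move=> OD; rewrite floorK // Cint_rat_Aint ?eigval_Aint.
have off_diag D : nontrivial_orbital D -> [set y | (y, y) \in D] = set0.
  case/andP=> OD ntD; apply/setP=> y; rewrite !inE; apply: contraNF ntD => Dyy.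
  by rewrite (orbital_eq OD Dyy) -diagonal_orbital.
have tr1 D : nontrivial_orbital D -> (subdegree D x)%:R + p%:R * eigval i1 D +
    p%:R * eigval i2 D + (p%:Z - 1)%:~R * (v D)%:~R = 0 :> algC.
  move=> nD; have OD := nontrP _ nD.
  rewrite -vE // -(eigval_triv trG) // -(sumC (fun i => eigval i D)).
  by rewrite eigval_tr1 // off_diag // cards0.
(* The zero trace makes [(v - n) / p] a sum of algebraic integers, where [n] is the subdegree; being
   rational it is an integer, negative since [v < n]. *)
have kP D : nontrivial_orbital D -> exists2 k : int, 0 < k & (subdegree D x)%:Z = p%:Z * k + v D.
  move=> nD; have OD := nontrP _ nD; have /andP[_ ntD] := nD.
  have E : (v D - (subdegree D x)%:Z)%:~R / p%:R = eigval i1 D + eigval i2 D + (v D)%:~R.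
    apply: (mulIf p_neq0); rewrite divfK //.
    by apply: (lincomb (esym (tr1 D nD))); ring.
  have : ((v D - (subdegree D x)%:Z)%:~R / p%:R : algC) \in Num.int.
    apply: Cint_rat_Aint; first by rewrite rpred_div ?rpred_int ?rpred_nat.
    by rewrite E !rpredD ?eigval_Aint // Aint_int.
  case/intrP=> k /(canRL (divfK p_neq0)) Dk; exists (- k); last first.
    by apply: (@intr_inj algC); apply: (lincomb (esym Dk)); ring.
  have := eigval_lt mult_free trG x primG C3 z3 OD ntD.
  rewrite vE // realz => /(_ isT); rewrite -subr_gt0.
  have -> : (subdegree D x)%:R - (v D)%:~R = (- k)%:~R * p%:R :> algC.
    by apply: (lincomb (esym Dk)); ring.
  by rewrite pmulr_lgt0 ?ltr0n ?ltr0z.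
have S i : i != 0 -> i \in constituents G -> \sum_(D | nontrivial_orbital D) eigval i D = -1.
  move=> zi Ci; have := sum_eigval trG zi.
  rewrite (sum_nontrivial _ x) (eigval_diag mult_free) // => E.
  by apply: (lincomb E); ring.
have Sv : \sum_(D | nontrivial_orbital D) v D = -1.
  apply: (@intr_inj algC); rewrite rmorph_sum rmorphN1 -(S i3) //.
  by apply: eq_bigr => D nD; exact/esym/vE/nontrP.
have Sn : \sum_(D | nontrivial_orbital D) (subdegree D x)%:Z = 3 * p%:Z - 1.
  have := sum_subdegree x; rewrite (bigD1 (diagonal T)) ?diagonal_in_orbitals //=.
  rewrite subdegree_diagonal cardT => /(congr1 Posz).
  rewrite PoszD (big_morph Posz PoszD (erefl _)) PoszM => <-; ring.
have card3 : #|[pred D | nontrivial_orbital D]| = 3%N.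
  have := cardsD1 (diagonal T) (orbitals G).
  rewrite typeIV_rank diagonal_in_orbitals // add1n => -[->].
  by apply: eq_card => D; rewrite !inE andbC.
(* The three integers [k] of [kP] are positive and, by [Sn] and [Sv], add up to 3; so each of them
   is 1. *)
have k1 D : nontrivial_orbital D -> (subdegree D x)%:Z = p%:Z + v D.
  have q_ge0 E : nontrivial_orbital E -> 0 <= (subdegree E x)%:Z - v E - p%:Z.
    move=> /kP[k k_gt0 ->]; rewrite addrK -{2}[p%:Z]mulr1 -mulrBr.
    by rewrite mulr_ge0 // subr_ge0 -gtz0_ge1.
  move=> nD; have : \sum_(E | nontrivial_orbital E) ((subdegree E x)%:Z - v E - p%:Z) == 0.
    by rewrite !sumrB Sn Sv sumr_const card3; apply/eqP; ring.
  rewrite psumr_eq0 // => /allP/(_ D (mem_index_enum _)); rewrite nD /=.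
  by rewrite -addrA -opprD subr_eq0 [v D + _]addrC => /eqP.
have card_meet (D E : {set T * T}) : nontrivial_orbital D -> nontrivial_orbital E ->
    #|D :&: paired E|%:R = ((3 * p%:Z * (p%:Z + v D)) *+ (E == paired D))%:~R :> algC.
  move=> nD nE; have [OD OE] := (nontrP _ nD, nontrP _ nE).
  have [->|nED] := eqVneq E (paired D).
    by rewrite pairedK setIid (subdegree_card trG x OD) cardT -k1 // mulr1n -!PoszM.
  rewrite (_ : _ :&: _ = set0) ?cards0 //; apply/setP=> -[a b]; rewrite !inE.
  apply: contraNF nED => /andP[Dab Eab]; apply/eqP/(can_inj (@pairedK T)).
  rewrite pairedK; apply: (orbital_eqE _ _ Eab Dab) => //; exact: paired_orbital.
exists (eigval i1), (eigval i2), v; split.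
- move=> D nD; have OD := nontrP _ nD; split; rewrite ?k1 ?eigval_Aint //.
  apply: (mulfI p_neq0); have := tr1 D nD.
  rewrite -[(subdegree D x)%:R]/((subdegree D x)%:Z%:~R) k1 // => E.
  by apply: (lincomb E); ring.
- move=> D nD; rewrite !eigval_paired; split=> //.
  have OD := nontrP _ nD; have OD' := nontrP _ (pairedP _ nD).
  apply: (@intr_inj algC); rewrite -!vE // eigval_paired; exact: conj_Crat.
- by split; rewrite ?S.
- move=> D E nD nE; have [OD OE] := (nontrP _ nD, nontrP _ nE).
  rewrite /tr2 -card_meet // -(eigval_tr2 mult_free OD OE) sumC.
  rewrite !(eigval_triv trG x) // !vE //.
  rewrite -[(subdegree D x)%:R]/((subdegree D x)%:Z%:~R) k1 //.
  rewrite -[(subdegree E x)%:R]/((subdegree E x)%:Z%:~R) k1 //; ring.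
move=> D E F nD nE nF; have [OD OE OF] := And3 (nontrP _ nD) (nontrP _ nE) (nontrP _ nF).
have [c] := eigval_tr3 mult_free OD OE OF.
rewrite sumC !(eigval_triv trG x) // !vE // (subdegree_card trG x OD) cardT => trE; exists c.
move: trE.
rewrite -[(subdegree D x)%:R]/((subdegree D x)%:Z%:~R) k1 //.
rewrite -[(subdegree E x)%:R]/((subdegree E x)%:Z%:~R) k1 //.
rewrite -[(subdegree F x)%:R]/((subdegree F x)%:Z%:~R) k1 //.
rewrite -[(3 * p * subdegree D x * c)%N%:R]/((3 * p * subdegree D x * c)%N%:Z%:~R).
rewrite !PoszM k1 // => trE.
by apply: (lincomb trE); rewrite /tr3; ring.
Qed.
End Spectrum.

(** * Arithmetic of the eigenvalues *)

Lemma prime_not_square (p : nat) (k : int) : prime p -> p%:Z = k ^+ 2 -> False.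
Proof.
move=> pr_p /(congr1 absz); rewrite abszX absz_nat => Dp.
have pk : (`|k| %| p)%N by rewrite Dp dvdn_mulr.
by case/primeP: pr_p => p1 /(_ _ pk)/orP[] /eqP k1; rewrite k1 in Dp; nia.
Qed.

Lemma mul_consec_ge0 (s : int) : 0 <= s * (s + 1).
Proof.
have [s_ge0|s_lt0] := lerP 0 s; first by rewrite mulr_ge0 // addr_ge0.
by apply: mulr_le0; lia.
Qed.

(** With [A = S(8S + 3)] and [Z = m - 3S - 6S^2] one has [3A <= 5(m - Z)], hence
    [12AZ <= 20(m - Z)Z <= 5m^2]. So [AZ] is nonnegative and smaller than its divisor, and the
    cofactor [Y] is 0. *)
Lemma quotient_bound (m S Y : int) :
  0 < m -> 0 <= m - 3 * S - 6 * S ^+ 2 ->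
  S * (8 * S + 3) * (m - 3 * S - 6 * S ^+ 2) = (6 * m ^+ 2 + 3 * m - S) * Y ->
  S * (8 * S + 3) * (m - 3 * S - 6 * S ^+ 2) = 0.
Proof.
move=> m_gt0.
have s0 : 0 <= S ^+ 2 by rewrite sqr_ge0.
have s1 : 0 <= S * (S + 1) by apply: mul_consec_ge0.
have [A DA] : exists A, A = S * (8 * S + 3) by eexists.
have [Z DZ] : exists Z, Z = m - 3 * S - 6 * S ^+ 2 by eexists.
rewrite -DA -DZ => Z_ge0 LY.
have A_ge0 : 0 <= A by move: DA s0 s1; rewrite expr2; clear; nia.
have AZ : 3 * A <= 5 * (m - Z) by move: DA DZ s0 s1; rewrite expr2; clear; nia.
have Sm : S <= m by move: DZ s1 Z_ge0; rewrite expr2; clear; nia.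
have sq : 0 <= (m - 2 * Z) ^+ 2 by rewrite sqr_ge0.
have AZ_ge0 : 0 <= A * Z by rewrite mulr_ge0.
have AZ_le : 12 * (A * Z) <= 5 * m ^+ 2.
  have h : 0 <= (5 * (m - Z) - 3 * A) * Z by rewrite mulr_ge0 // subr_ge0.
  by move: h sq; rewrite !expr2; clear; nia.
have AZ_lt : A * Z < 6 * m ^+ 2 + 3 * m - S.
  by move: AZ_le Sm m_gt0; rewrite !expr2; clear; nia.
move: AZ_ge0 AZ_lt; rewrite LY; set G := (_ + _ - _).
move=> GY_ge0 GY_lt; have G_gt0 := le_lt_trans GY_ge0 GY_lt.
move: GY_ge0 GY_lt; rewrite pmulr_rge0 // -{2}[G]mulr1 ltr_pM2l // => Y_ge0 Y_lt1.
by rewrite (_ : Y = 0) ?mulr0 //; clear -Y_ge0 Y_lt1; lia.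
Qed.

(** Here [v_i = 2w_i - 1], the numbers [2m + 3w_i - 3w_i^2] are the squares of the half-differences
    [(l_i - m_i)/2], and the [a_i] are intersection numbers. *)
Lemma selfpaired_arith (p : nat) (m w1 w2 w3 a1 a2 a3 : int) :
  let e2 := w1 * w2 + w1 * w3 + w2 * w3 in
  prime p -> p%:Z = 2 * m + 1 -> 0 < m -> w1 + w2 + w3 = 1 ->
  0 <= 2 * m + 3 * w1 - 3 * w1 ^+ 2 ->
  0 <= 2 * m + 3 * w2 - 3 * w2 ^+ 2 ->
  0 <= 2 * m + 3 * w3 - 3 * w3 ^+ 2 ->
  (m + 3 * w1 * w2) ^+ 2 =
    (2 * m + 3 * w1 - 3 * w1 ^+ 2) * (2 * m + 3 * w2 - 3 * w2 ^+ 2) ->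
  3 * (m + w1) * a1 = 2 * m * (1 - 4 * e2 - m) ->
  3 * (m + w2) * a2 = 2 * m * (1 - 4 * e2 - m) ->
  3 * (m + w3) * a3 = 2 * m * (1 - 4 * e2 - m) ->
  [\/ w2 = w3 /\ 2 * m + 3 * w1 - 3 * w1 ^+ 2 = 0,
      w3 = w1 /\ 2 * m + 3 * w2 - 3 * w2 ^+ 2 = 0 |
      w1 = w2 /\ 2 * m + 3 * w3 - 3 * w3 ^+ 2 = 0].
Proof.
move=> e2 pr_p Dp m_gt0 sw d1 d2 d3 rel K1 K2 K3.
have nzm : m != 0 by rewrite gt_eqF.
have Dw3 : w3 = 1 - w1 - w2 by rewrite -sw; ring.
pose e3 := w1 * w2 * w3; pose S := - m - 2 * e2.
have mS : m * S = 3 * e3.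
  have n3 : (3 : int) != 0 by [].
  apply: (mulfI n3); apply: (lincomb rel); rewrite /S /e3 /e2 Dw3; ring.
pose G := 6 * m ^+ 2 + 3 * m - S; pose E := a1 * a2 + a1 * a3 + a2 * a3.
pose K := 2 * m * (1 + m + 2 * S).
have {}K1 : 3 * (m + w1) * a1 = K by rewrite K1 /K /S; ring.
have {}K2 : 3 * (m + w2) * a2 = K by rewrite K2 /K /S; ring.
have {}K3 : 3 * (m + w3) * a3 = K by rewrite K3 /K /S; ring.
(* The elementary symmetric functions of the [w_i] are [1], [-(m + S)/2] and [mS/3], so the product
   depends on [m] and [S] alone. *)
have PN : 6 * ((m + w1) * (m + w2) * (m + w3)) = m * G.
  by apply: (lincomb (congr1 ( *%R (-2)) mS)); rewrite /G /S /e3 /e2 Dw3; ring.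
have EG : 3 * E * G = 8 * m * (3 * m + 1) * (1 + m + 2 * S) ^+ 2.
  have nz : 3 * m != 0 by rewrite mulf_neq0.
  apply: (mulfI nz).
  transitivity (6 * (9 * E * ((m + w1) * (m + w2) * (m + w3)))).
    by apply: (lincomb (congr1 ( *%R (- 9 * E)) PN)); ring.
  transitivity (6 * (K ^+ 2 * (3 * m + 1))); last by rewrite /K; ring.
  (* The factors [m + w_i] add up to [3m + 1]; in each term [K^2] is written with the other two
     indices. *)
  have -> : K ^+ 2 * (3 * m + 1) =
      3 * (m + w2) * a2 * (3 * (m + w3) * a3) * (m + w1) +
      3 * (m + w1) * a1 * (3 * (m + w3) * a3) * (m + w2) +
      3 * (m + w1) * a1 * (3 * (m + w2) * a2) * (m + w3).
    by rewrite K1 K2 K3 Dw3; ring.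
  by rewrite /E; ring.
have [Y LY] : exists Y, S * (8 * S + 3) * (m - 3 * S - 6 * S ^+ 2) = G * Y.
  (* Modulo G, S = 3m(2m + 1), so that the product is
     - 72 m^2 (2m + 1) (4m + 1)^2 (3m + 1)^3; the cofactor below comes from
     the division of polynomials in S by S - c. *)
  pose c := 6 * m ^+ 2 + 3 * m.
  pose H := 72 * m ^+ 2 * (2 * m + 1) * (3 * m + 1).
  pose q2 := - 42 - 48 * c; pose q1 := 8 * m - 9 + 4 * H + c * q2.
  pose q0 := 3 * m + 4 * H * (1 + m) + c * q1.
  exists (- (- 48 * S ^+ 3 + q2 * S ^+ 2 + q1 * S + q0) - 27 * m * (2 * m + 1) * E).
  apply: (lincomb (congr1 ( *%R (9 * m * (2 * m + 1))) EG)).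
  rewrite /q0 /q1 /q2 /H /c /G; ring.
(* Twice the product of the three squares is [m^2] times [m - 3S - 6S^2]: the latter is nonnegative,
   and it vanishes only if some square does. *)
have rel_Z : (2 * m + 3 * w1 - 3 * w1 ^+ 2) * (2 * m + 3 * w2 - 3 * w2 ^+ 2) *
   (2 * m + 3 * w3 - 3 * w3 ^+ 2) * 2 = m ^+ 2 * (m - 3 * S - 6 * S ^+ 2).
  apply: (lincomb (congr1 ( *%R (- (3 * m - 9 * S - 18 * e3 - 6 * m * S))) mS)).
  by rewrite /S /e3 /e2 Dw3; ring.
have Z_ge0 : 0 <= m - 3 * S - 6 * S ^+ 2.
  have m2 : 0 < m ^+ 2 by rewrite exprn_gt0.
  by rewrite -(pmulr_rge0 _ m2) -rel_Z !mulr_ge0.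
have L0 := quotient_bound m_gt0 Z_ge0 LY.
have S83 : 8 * S + 3 != 0 by apply/eqP; clear; lia.
move/eqP: L0; rewrite !mulf_eq0 (negPf S83) orbF => /orP[/eqP S0 | /eqP Z0].
  (* If [S = 0], some [w_i] is 0 and the other two add up to 1; then [p = 1 - 4 e2] is [(1 - 2w)^2]
     for either of these. *)
  have /eqP : e3 = 0 by move: mS; rewrite S0 mulr0; clear; lia.
  have m2 : m = - 2 * e2 by apply: (lincomb (esym S0)); rewrite /S; ring.
  rewrite /e3 !mulf_eq0 -orbA => /or3P[] /eqP w0; exfalso.
  - by apply: (prime_not_square (k := 1 - 2 * w2) pr_p); rewrite Dp m2 /e2 Dw3 w0; ring.
  - by apply: (prime_not_square (k := 1 - 2 * w1) pr_p); rewrite Dp m2 /e2 Dw3 w0; ring.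
  have w2E : w2 = 1 - w1 by rewrite -sw w0; ring.
  by apply: (prime_not_square (k := 1 - 2 * w1) pr_p); rewrite Dp m2 /e2 w0 w2E; ring.
have rel13 : (m + 3 * w1 * w3) ^+ 2 =
    (2 * m + 3 * w1 - 3 * w1 ^+ 2) * (2 * m + 3 * w3 - 3 * w3 ^+ 2).
  by apply: (lincomb rel); rewrite Dw3; ring.
have rel23 : (m + 3 * w2 * w3) ^+ 2 =
    (2 * m + 3 * w2 - 3 * w2 ^+ 2) * (2 * m + 3 * w3 - 3 * w3 ^+ 2).
  by apply: (lincomb rel); rewrite Dw3; ring.
(* If the square at [a] is 0, then so are [m + 3ab] and [m + 3ac]; as [m] is nonzero, so is [a], and
   [b = c]. *)
have eqw a b c : 2 * m + 3 * a - 3 * a ^+ 2 = 0 ->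
    (m + 3 * a * b) ^+ 2 = 0 -> (m + 3 * a * c) ^+ 2 = 0 -> b = c.
  move=> Da /eqP; rewrite sqrf_eq0 => /eqP Eb /eqP; rewrite sqrf_eq0 => /eqP Ec.
  have nza : 3 * a != 0.
    by rewrite mulf_eq0 /=; apply: contraNneq nzm => a0; rewrite -Eb a0; apply/eqP; ring.
  by apply: (mulfI nza); apply: (addrI m); rewrite Eb Ec.
move/eqP: rel_Z; rewrite Z0 mulr0 !mulf_eq0 orbF -orbA => /or3P[] /eqP D0.
- by apply: Or31; split=> //; apply: (eqw w1) => //; rewrite ?rel ?rel13 D0 mul0r.
- apply: Or32; split=> //; apply: (eqw w2) => //.
    by rewrite rel23 D0 mul0r.
  by rewrite -(mulr0 (2 * m + 3 * w1 - 3 * w1 ^+ 2)) -D0 -rel; ring.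
apply: Or33; split=> //; apply: (eqw w3) => //.
  by rewrite -(mulr0 (2 * m + 3 * w1 - 3 * w1 ^+ 2)) -D0 -rel13; ring.
by rewrite -(mulr0 (2 * m + 3 * w2 - 3 * w2 ^+ 2)) -D0 -rel23; ring.
Qed.

(** The half-sum is known from the trace, so only products of half-differences remain to be
    found. *)
Lemma halve (l m : algC) (s : algC) : l + m = s ->
  exists d, [/\ d = (l - m) / 2, l = s / 2 + d & m = s / 2 - d].
Proof. by move=> <-; exists ((l - m) / 2); split=> //; field. Qed.

(* The parity comes from the algebraic integer l * m being rational. *)
Lemma selfpaired_parity (p : nat) (l m : algC) (v : int) : (0 < p)%N ->
  l + m = (- 1 - v%:~R) -> l \in Aint -> m \in Aint ->
  tr2 p l l m m v v = (3 * p%:Z * (p%:Z + v))%:~R ->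
  exists w : int, v = 2 * w - 1 /\
    ((l - m) / 2) ^+ 2 = (p%:Z - 1 + 3 * w - 3 * w ^+ 2)%:~R.
Proof.
move=> p_gt0 slm Al Am tr.
have nzp : p%:R != 0 :> algC by rewrite pnatr_eq0 -lt0n.
have Elm : 2 * (l * m) = (2 * v ^+ 2 + v + 1 - 2 * p%:Z)%:~R.
  have Dm : m = - 1 - v%:~R - l by rewrite -slm; ring.
  by apply: (mulfI nzp); apply: (lincomb (esym tr)); rewrite /tr2 Dm; ring.
have /intrP[z Dz] : l * m \in Num.int.
  apply: Cint_rat_Aint; last exact: rpredM.
  have n2 : (2 : algC) != 0 by rewrite pnatr_eq0.
  by rewrite -(mulKf n2 (l * m)) Elm rpredM ?rpredV ?rpred_nat ?rpred_int.
(* The right side has the parity of [v + 1], so [v] is odd. *)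
have Ez : 2 * z = 2 * v ^+ 2 + v + 1 - 2 * p%:Z.
  by apply: (@intr_inj algC); rewrite -Elm Dz; ring.
have Dv : v = 2 * (z - v ^+ 2 + p%:Z) - 1 by apply: (lincomb (esym Ez)); ring.
exists (z - v ^+ 2 + p%:Z); split=> //.
set w := z - _ + _ in Dv *.
have Dz' : z = w + v ^+ 2 - p%:Z by rewrite /w; ring.
have slmw : l + m = - 2 * w%:~R by rewrite slm {1}Dv; ring.
have n4 : (4 : algC) != 0 by rewrite pnatr_eq0.
apply: (mulfI n4); transitivity ((l + m) ^+ 2 - 4 * (l * m)); first by field.
by rewrite slmw Dz Dz' Dv; ring.
Qed.

Lemma selfpaired_spectrum (p : nat) (l1 l2 l3 m1 m2 m3 : algC) (v1 v2 v3 : int)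
    (c1 c2 c3 : int) :
  prime p -> (5 <= p)%N -> v1 + v2 + v3 = - 1 ->
  [/\ 0 < p%:Z + v1, 0 < p%:Z + v2 & 0 < p%:Z + v3] ->
  [/\ l1 + m1 = (- 1 - v1%:~R), l2 + m2 = (- 1 - v2%:~R) & l3 + m3 = (- 1 - v3%:~R)] ->
  [/\ l1 \in Aint, l2 \in Aint & l3 \in Aint] ->
  [/\ m1 \in Aint, m2 \in Aint & m3 \in Aint] ->
  [/\ l1 = l1^*, l2 = l2^* & l3 = l3^*] ->
  [/\ m1 = m1^*, m2 = m2^* & m3 = m3^*] ->
  [/\ tr2 p l1 l1 m1 m1 v1 v1 = (3 * p%:Z * (p%:Z + v1))%:~R,
      tr2 p l2 l2 m2 m2 v2 v2 = (3 * p%:Z * (p%:Z + v2))%:~R &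
      tr2 p l3 l3 m3 m3 v3 v3 = (3 * p%:Z * (p%:Z + v3))%:~R] ->
  [/\ tr2 p l1 l2 m1 m2 v1 v2 = 0, tr2 p l1 l3 m1 m3 v1 v3 = 0 &
      tr2 p l2 l3 m2 m3 v2 v3 = 0] ->
  [/\ tr3 p l1 l2 l3 m1 m2 m3 v1 v2 v3 = (3 * p%:Z * (p%:Z + v1) * c1)%:~R,
      tr3 p l2 l3 l1 m2 m3 m1 v2 v3 v1 = (3 * p%:Z * (p%:Z + v2) * c2)%:~R &
      tr3 p l3 l1 l2 m3 m1 m2 v3 v1 v2 = (3 * p%:Z * (p%:Z + v3) * c3)%:~R] ->
  exists a : int, [/\ (2 %| a)%Z, p%:Z = 3 * a ^+ 2 + 3 * a + 1 &
    [\/ [/\ v1 = 2 * a + 1, v2 = - a - 1 & v3 = - a - 1],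
        [/\ v2 = 2 * a + 1, v3 = - a - 1 & v1 = - a - 1] |
        [/\ v3 = 2 * a + 1, v1 = - a - 1 & v2 = - a - 1]]].
Proof.
move=> pr_p p_ge5 sv [n1 n2 n3] [s1 s2 s3] [Al1 Al2 Al3] [Am1 Am2 Am3].
move=> [rl1 rl2 rl3] [rm1 rm2 rm3] [t11 t22 t33] [t12 t13 t23] [T1 T2 T3].
have p_gt0 : (0 < p)%N by apply: leq_trans p_ge5.
have nzp : p%:R != 0 :> algC by rewrite pnatr_eq0 -lt0n.
have nzpZ : p%:Z != 0 by rewrite -lt0n.
have [m [Dp m_gt0]] : exists m : int, p%:Z = 2 * m + 1 /\ 0 < m.
  have p_odd : odd p by case/even_prime: pr_p => // p2; rewrite p2 in p_ge5.
  have := odd_double_half p; rewrite p_odd => Dp.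
  by exists p./2%:Z; clear -Dp p_ge5; lia.
have [w1 [Dv1 d1]] := selfpaired_parity p_gt0 s1 Al1 Am1 t11.
have [w2 [Dv2 d2]] := selfpaired_parity p_gt0 s2 Al2 Am2 t22.
have [w3 [Dv3 d3]] := selfpaired_parity p_gt0 s3 Al3 Am3 t33.
have sw : w1 + w2 + w3 = 1.
  have nz2 : (2 : int) != 0 by [].
  by apply: (mulfI nz2); apply: (lincomb sv); rewrite Dv1 Dv2 Dv3; ring.
have Dw3 : w3 = 1 - w1 - w2 by rewrite -sw; ring.
(* Self-paired orbitals have real eigenvalues, so the squared half-differences are nonnegative. *)
have real_sqr (x y : algC) (z : int) : x = x^* -> y = y^* ->
    ((x - y) / 2) ^+ 2 = z%:~R -> 0 <= z.
  move=> rx ry E; rewrite -(ler0z algC) -E real_exprn_even_ge0 //.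
  by rewrite rpred_div ?rpredB ?rpred_nat //; apply/CrealP; rewrite -?rx -?ry.
have := real_sqr _ _ _ rl1 rm1 d1; have := real_sqr _ _ _ rl2 rm2 d2.
have := real_sqr _ _ _ rl3 rm3 d3; rewrite Dp addrK => g3 g2 g1.
have [e1 [De1 L1 M1]] := halve s1; have [e2 [De2 L2 M2]] := halve s2.
have [e3 [De3 L3 M3]] := halve s3.
rewrite -De1 Dp addrK in d1; rewrite -De2 Dp addrK in d2; rewrite -De3 Dp addrK in d3.
have E12 : e1 * e2 = (- (m + 3 * w1 * w2))%:~R.
  have nz2 : 2 * p%:R != 0 :> algC by rewrite mulf_neq0 ?pnatr_eq0.
  apply: (mulfI nz2); apply: (lincomb t12); rewrite /tr2 L1 L2 M1 M2 Dv1 Dv2.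
  by rewrite -[p%:R]/(p%:Z%:~R) Dp; field.
have E13 : e1 * e3 = (- (m + 3 * w1 * w3))%:~R.
  have nz2 : 2 * p%:R != 0 :> algC by rewrite mulf_neq0 ?pnatr_eq0.
  apply: (mulfI nz2); apply: (lincomb t13); rewrite /tr2 L1 L3 M1 M3 Dv1 Dv3.
  by rewrite -[p%:R]/(p%:Z%:~R) Dp; field.
have E23 : e2 * e3 = (- (m + 3 * w2 * w3))%:~R.
  have nz2 : 2 * p%:R != 0 :> algC by rewrite mulf_neq0 ?pnatr_eq0.
  apply: (mulfI nz2); apply: (lincomb t23); rewrite /tr2 L2 L3 M2 M3 Dv2 Dv3.
  by rewrite -[p%:R]/(p%:Z%:~R) Dp; field.
have rel : (m + 3 * w1 * w2) ^+ 2 =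
    (2 * m + 3 * w1 - 3 * w1 ^+ 2) * (2 * m + 3 * w2 - 3 * w2 ^+ 2).
  apply: (@intr_inj algC); transitivity ((e1 * e2) ^+ 2); first by rewrite E12; ring.
  by rewrite exprMn d1 d2; ring.
pose cube := 2 * m * (1 - 4 * (w1 * w2 + w1 * w3 + w2 * w3) - m).
have cubeE : tr3 p l1 l2 l3 m1 m2 m3 v1 v2 v3 = (2 * p%:Z * cube)%:~R.
  (* Terms of odd degree in the half-differences cancel between the two products; the rest is known
     from [E12], [E13] and [E23]. *)
  have lm3 : l1 * (l2 * l3) + m1 * (m2 * m3) = (16 * (w1 * w2 * w3) + 2 * m)%:~R.
    apply: (lincomb (congr2 +%R (congr2 +%R (congr1 ( *%R (- 2 * w1%:~R)) E23)
      (congr1 ( *%R (- 2 * w2%:~R)) E13)) (congr1 ( *%R (- 2 * w3%:~R)) E12))).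
    by rewrite L1 L2 L3 M1 M2 M3 Dv1 Dv2 Dv3 Dw3; field.
  rewrite /tr3 lm3 -[p%:R]/(p%:Z%:~R) -!(rmorphM, rmorphD); congr (_%:~R).
  have nz3 : (3 : int) != 0 by [].
  apply: (mulfI nz3); apply: (lincomb (congr1 ( *%R (- 8 * (2 * m + 1))) rel)).
  by rewrite /cube Dv1 Dv2 Dv3 Dp Dw3; ring.
(* The triple trace is cyclically symmetric: each rotation brings in another subdegree, with the
   same right side [cube]. *)
have K (w v c : int) (t : algC) : v = 2 * w - 1 -> t = (2 * p%:Z * cube)%:~R ->
    t = (3 * p%:Z * (p%:Z + v) * c)%:~R -> 3 * (m + w) * c = cube.
  move=> Dv -> /intr_inj E; have nz2 : 2 * p%:Z != 0 by rewrite mulf_neq0.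
  by apply: (mulfI nz2); rewrite E Dv Dp; ring.
have K1 := K _ _ _ _ Dv1 cubeE T1.
have K2 : 3 * (m + w2) * c2 = cube.
  by apply: K Dv2 _ T2; rewrite -cubeE /tr3; ring.
have K3 : 3 * (m + w3) * c3 = cube.
  by apply: K Dv3 _ T3; rewrite -cubeE /tr3; ring.
have even2 (x : int) : (2 %| - 2 * x)%Z by rewrite dvdz_mulr.
have [[w23 D0]|[w31 D0]|[w12 D0]] :=
    selfpaired_arith pr_p Dp m_gt0 sw g1 g2 g3 rel K1 K2 K3.
(* If [w] is the common value of the two equal [w_i], then [a = -2w] turns their [v_i = 2w - 1] into
   [- a - 1] and the third one into [2a + 1]. *)
- have w1E : w1 = 1 - 2 * w2 by apply: (lincomb sw); rewrite w23; ring.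
  exists (- 2 * w2); split; first exact: even2.
    by apply: (lincomb D0); rewrite w1E; ring.
  by apply: Or31; rewrite Dv1 Dv2 Dv3 -w23 w1E; split; ring.
- have w2E : w2 = 1 - 2 * w3 by apply: (lincomb sw); rewrite w31; ring.
  exists (- 2 * w3); split; first exact: even2.
    by apply: (lincomb D0); rewrite w2E; ring.
  by apply: Or32; rewrite Dv1 Dv2 Dv3 -w31 w2E; split; ring.
have w3E : w3 = 1 - 2 * w1 by apply: (lincomb sw); rewrite w12; ring.
exists (- 2 * w1); split; first exact: even2.
  by apply: (lincomb D0); rewrite w3E; ring.
by apply: Or33; rewrite Dv1 Dv2 Dv3 -w12 w3E; split; ring.
Qed.

(** Here [l] and [m] belong to an orbital distinct from its pair, whose eigenvalues are the
    conjugates. The quadratic traces yield [p], the cubic ones the parity of [v]. *)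
Lemma paired_spectrum (p : nat) (l m : algC) (v c c' : int) :
  (0 < p)%N -> 0 < p%:Z + v -> l + m = (- 1 - v%:~R) ->
  tr2 p l l m m v v = 0 ->
  tr2 p l l^* m m^* v v = (3 * p%:Z * (p%:Z + v))%:~R ->
  tr3 p l l l m m m v v v = (3 * p%:Z * (p%:Z + v) * c)%:~R ->
  tr3 p l l l^* m m m^* v v v = (3 * p%:Z * (p%:Z + v) * c')%:~R ->
  p%:Z = 3 * v ^+ 2 + 3 * v + 1 /\ (2 %| v)%Z.
Proof.
move=> p_gt0 n_gt0 s t22 t23 T T'.
have nzp : p%:R != 0 :> algC by rewrite pnatr_eq0 -lt0n.
have [d [Dd L M]] := halve s.
have cs : (- 1 - v%:~R : algC)^* = - 1 - v%:~R by rewrite rmorphB rmorphN1 rmorph_int.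
have Lc : l^* = (- 1 - v%:~R) / 2 + d^*.
  by rewrite L rmorphD fmorph_div /= cs conjC_nat.
have Mc : m^* = (- 1 - v%:~R) / 2 - d^*.
  by rewrite M rmorphB fmorph_div /= cs conjC_nat.
have nz2p : p%:R / 2 != 0 :> algC by rewrite mulf_neq0 // invr_neq0 // pnatr_eq0.
have E22 : 4 * d ^+ 2 = (- (2 * p%:Z + 1 + 6 * v + 3 * v ^+ 2))%:~R.
  by apply: (mulfI nz2p); apply: (lincomb t22); rewrite /tr2 L M; field.
have E23 : 4 * (d * d^*) = (4 * p%:Z - 1 - 3 * v ^+ 2)%:~R.
  by apply: (mulfI nz2p); apply: (lincomb t23); rewrite /tr2 Lc Mc L M; field.
have n4 : (4 : algC) != 0 by rewrite pnatr_eq0.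
(* [d ^+ 2] is real, so [d] is real or purely imaginary; in the real case [E22] and [E23] would give
   [p + v = 0]. *)
have /eqP : (d - d^*) * (d + d^*) = 0.
  have E22c : 4 * (d^*) ^+ 2 = 4 * d ^+ 2.
    have /(congr1 (fun z : algC => z^*)) := E22.
    by rewrite rmorphM rmorphXn /= conjC_nat rmorph_int -E22.
  by move/(mulfI n4): E22c => E; apply: (lincomb (esym E)); ring.
rewrite mulf_eq0 => /orP[]; rewrite ?subr_eq0 ?addr_eq0 => /eqP Edc.
  exfalso; have : 6 * (p%:Z + v) = 0.
    apply: (@intr_inj algC); rewrite -Edc in E23.
    by apply: (lincomb (congr2 +%R E22 (esym E23))); ring.
  by move=> /eqP; rewrite mulf_eq0 (gt_eqF n_gt0).
have {}Edc : d^* = - d by rewrite [in RHS]Edc opprK.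
have Dp : p%:Z = 3 * v ^+ 2 + 3 * v + 1.
  apply: (@intr_inj algC).
  have n2 : (2 : algC) != 0 by rewrite pnatr_eq0.
  apply: (mulfI n2); rewrite Edc in E23.
  by apply: (lincomb (congr2 +%R (esym E22) (esym E23))); ring.
split=> //.
have nzpv : 3 * (p%:Z + v) != 0 by rewrite mulf_neq0 // gt_eqF.
have Ecc : c' - c = - 1 - v.
  apply: (mulfI nzpv); apply: (@intr_inj algC); apply: (mulfI nzp).
  rewrite Edc in Lc Mc E23.
  apply: (lincomb (congr2 +%R (congr2 +%R (esym T') T)
    (congr1 ( *%R (p%:R * (- 1 - v%:~R))) E23))).
  by rewrite /tr3 Lc Mc L M -[p%:R]/(p%:Z%:~R) Dp; field.
(* The two intersection numbers have an odd sum, hence also an odd difference [- 1 - v]. *)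
have Ecc' : c' + c = 2 * (1 + v) ^+ 2 - 1.
  apply: (mulfI nzpv); apply: (@intr_inj algC); apply: (mulfI nzp).
  rewrite Edc in Lc Mc E23.
  apply: (lincomb (congr2 +%R (congr2 +%R (esym T') (esym T))
    (congr1 ( *%R (p%:R * (- 1 - v%:~R) / 2)) (esym E23)))).
  by rewrite /tr3 Lc Mc L M -[p%:R]/(p%:Z%:~R) Dp; field.
have -> : v = 2 * ((1 + v) ^+ 2 - 1 - c') by apply: (lincomb (congr2 +%R Ecc Ecc')); ring.
by rewrite dvdz_mulr.
Qed.

(** Besides [a], only [- 1 - a] gives the same value, and it has the opposite parity. *)
Lemma centred_hex_inj (a b : int) : (2 %| a)%Z = (2 %| b)%Z ->
  3 * a ^+ 2 + 3 * a + 1 = 3 * b ^+ 2 + 3 * b + 1 -> a = b.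
Proof.
move=> par E; have /eqP : (a - b) * (a + b + 1) = 0.
  have n3 : (3 : int) != 0 by [].
  by apply: (mulfI n3); apply: (lincomb E); ring.
rewrite mulf_eq0 subr_eq0 => /orP[/eqP // | /eqP ab].
have Da : a = - b - 1 by apply: (lincomb ab); ring.
by move: par; rewrite Da !dvdzE; clear; lia.
Qed.

(** * Suborbits of a group of type IV *)

Section Labelling.
Variables (p : nat) (T : finType) (G : {group {perm T}}).
Hypotheses (pr_p : prime p) (p_ge5 : (5 <= p)%N) (cardT : #|T| = (3 * p)%N).
Hypotheses (primG : [primitive G, on [set: T] | 'P]) (IV : typeIV G p).

Let trG : [transitive G, on [set: T] | 'P].
Proof. by case/andP: primG. Qed.

Lemma subdegree_gt0 D x : D \in orbitals G -> (0 < subdegree D x)%N.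
Proof.
move=> OD; have := orbital_card_gt0 OD.
by rewrite (subdegree_card trG x OD) muln_gt0 => /andP[].
Qed.

Section Labelled.
Variables (x : T) (D1 D2 D3 : {set T * T}).
Hypotheses (Unq : uniq [:: diagonal T; D1; D2; D3])
           (OG : orbitals G = [set diagonal T; D1; D2; D3]).

Lemma nontrivial_labelled D : nontrivial_orbital G D = (D \in [:: D1; D2; D3]).
Proof.
rewrite /nontrivial_orbital OG !inE -!orbA andbC.
case: eqVneq => //= ->; move: Unq; rewrite /= !inE !negb_or.
by case/andP=> /and3P[/negPf-> /negPf-> /negPf->].
Qed.

Lemma sum_labelled (R : zmodType) (F : {set T * T} -> R) :
  \sum_(D | nontrivial_orbital G D) F D = F D1 + F D2 + F D3.
Proof.
rewrite (eq_bigl _ _ nontrivial_labelled) -big_uniq /=; last by case/andP: Unq.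
by rewrite !big_cons big_nil addr0 addrA.
Qed.

Lemma labelled_selfpaired :
  paired D1 = D1 -> paired D2 = D2 -> paired D3 = D3 ->
  exists a : int, [/\ (2 %| a)%Z, p%:Z = 3 * a ^+ 2 + 3 * a + 1 &
    [\/ [/\ (subdegree D1 x)%:Z = p%:Z + 2 * a + 1,
            (subdegree D2 x)%:Z = p%:Z - a - 1 & (subdegree D3 x)%:Z = p%:Z - a - 1],
        [/\ (subdegree D2 x)%:Z = p%:Z + 2 * a + 1,
            (subdegree D3 x)%:Z = p%:Z - a - 1 & (subdegree D1 x)%:Z = p%:Z - a - 1] |
        [/\ (subdegree D3 x)%:Z = p%:Z + 2 * a + 1,
            (subdegree D1 x)%:Z = p%:Z - a - 1 & (subdegree D2 x)%:Z = p%:Z - a - 1]]].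
Proof.
move=> P1 P2 P3; have [l [m [v [Hs Hc [_ _ Sv] H2 H3]]]] := spectrum p_ge5 cardT primG IV x.
have [N1 N2 N3] : [/\ nontrivial_orbital G D1, nontrivial_orbital G D2 & nontrivial_orbital G D3].
  by rewrite !nontrivial_labelled !inE !eqxx !orbT.
have [O1 O2 O3] : [/\ D1 \in orbitals G, D2 \in orbitals G & D3 \in orbitals G].
  by rewrite OG !inE !eqxx !orbT.
have [n1 s1 Al1 Am1] := Hs _ N1; have [n2 s2 Al2 Am2] := Hs _ N2.
have [n3 s3 Al3 Am3] := Hs _ N3.
have [cl1 cm1 _] := Hc _ N1; have [cl2 cm2 _] := Hc _ N2; have [cl3 cm3 _] := Hc _ N3.
rewrite P1 in cl1 cm1; rewrite P2 in cl2 cm2; rewrite P3 in cl3 cm3.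
have [c1 T1] := H3 _ _ _ N1 N2 N3; have [c2 T2] := H3 _ _ _ N2 N3 N1.
have [c3 T3] := H3 _ _ _ N3 N1 N2.
have t11 := H2 _ _ N1 N1; have t22 := H2 _ _ N2 N2; have t33 := H2 _ _ N3 N3.
have t12 := H2 _ _ N1 N2; have t13 := H2 _ _ N1 N3; have t23 := H2 _ _ N2 N3.
move: Unq; rewrite /= !inE !negb_or => /and4P[_ /andP[n12 n13] n23 _].
rewrite P1 eqxx in t11; rewrite P2 eqxx in t22; rewrite P3 eqxx in t33.
rewrite P1 eq_sym (negPf n12) in t12; rewrite P1 eq_sym (negPf n13) in t13.
rewrite P2 eq_sym (negPf n23) in t23.
have [||||||||||a [a2 Dp Ha]] := @selfpaired_spectrum p (l D1) (l D2) (l D3) (m D1) (m D2) (m D3)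
  (v D1) (v D2) (v D3) c1 c2 c3 pr_p p_ge5; try by split.
- by rewrite -Sv sum_labelled.
- by rewrite -n1 -n2 -n3 !ltz_nat !subdegree_gt0.
exists a; split=> //; rewrite n1 n2 n3.
by case: Ha => [[-> -> ->]|[-> -> ->]|[-> -> ->]];
  [apply: Or31 | apply: Or32 | apply: Or33]; split; ring.
Qed.

Lemma labelled_paired : paired D2 = D3 ->
  exists a : int, [/\ ~~ (2 %| a)%Z, p%:Z = 3 * a ^+ 2 + 3 * a + 1,
    (subdegree D1 x)%:Z = p%:Z + 2 * a + 1,
    (subdegree D2 x)%:Z = p%:Z - a - 1 & (subdegree D3 x)%:Z = p%:Z - a - 1].
Proof.
move=> P23; have [l [m [v [Hs Hc [_ _ Sv] H2 H3]]]] := spectrum p_ge5 cardT primG IV x.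
have [N1 N2 N3] : [/\ nontrivial_orbital G D1, nontrivial_orbital G D2 & nontrivial_orbital G D3].
  by rewrite !nontrivial_labelled !inE !eqxx !orbT.
have O2 : D2 \in orbitals G by rewrite OG !inE !eqxx !orbT.
have [n1 _ _ _] := Hs _ N1; have [n2 s2 _ _] := Hs _ N2; have [n3 _ _ _] := Hs _ N3.
have [cl cm cv] := Hc _ N2; rewrite P23 in cl cm cv.
move: Unq; rewrite /= !inE !negb_or => /and4P[_ /andP[n12 n13] n23 _].
have t22 := H2 _ _ N2 N2; rewrite P23 (negPf n23) in t22.
have t23 := H2 _ _ N2 N3; rewrite P23 eqxx cl cm cv in t23.
have [c t222] := H3 _ _ _ N2 N2 N2; have [c' t223] := H3 _ _ _ N2 N2 N3.
rewrite cl cm cv in t223.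
have n2_gt0 : 0 < p%:Z + v D2 by rewrite -n2 ltz_nat subdegree_gt0.
have [Dp v2] := paired_spectrum (leq_trans (isT : (0 < 5)%N) p_ge5) n2_gt0 s2 t22 t23 t222 t223.
rewrite sum_labelled cv in Sv.
have v1 : v D1 = - 1 - 2 * v D2 by apply: (lincomb Sv); ring.
(* Both [v D2] and [- 1 - v D2] represent [p]; as [v D2] is even, this choice is the odd one. *)
exists (- 1 - v D2); split.
- by move: v2; rewrite !dvdzE; clear; lia.
- by rewrite Dp; ring.
- by rewrite n1 v1; ring.
- by rewrite n2; ring.
by rewrite n3 cv; ring.
Qed.

(** Slicing at [x] maps the orbitals bijectively onto the suborbits, so equal lengths are counted
    with their multiplicity. *)
Lemma subdegrees_labelled : perm_eq (subdegrees G x)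
  [:: 1%N; subdegree D1 x; subdegree D2 x; subdegree D3 x].
Proof.
pose slice (D : {set T * T}) := [set y | (x, y) \in D].
have Dsub : suborbits G x = slice @: orbitals G.
  apply/setP=> B; apply/imsetP/imsetP => [[y _ ->]|[D OD ->]].
    exists (orbit (pair_action T) G (x, y)); first exact: orbital_refl.
    apply/setP=> z; rewrite inE.
    apply/orbitP/orbitP => [[g /setIP[Gg /astab1P gx] <-]|[g Gg [gx <-]]].
      by exists g => //=; rewrite /pair_aperm /= gx.
    by exists g => //; apply/setIP; split=> //; apply/astab1P.
  have /card_gt0P[y] := subdegree_gt0 x OD; rewrite inE => Dxy; exists y => //.
  rewrite (orbital_eq OD Dxy).
  apply/setP=> z; rewrite inE.
  apply/orbitP/orbitP => [[g Gg [gx <-]]|[g /setIP[Gg /astab1P gx] <-]].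
    by exists g => //; apply/setIP; split=> //; apply/astab1P.
  by exists g => //=; rewrite /pair_aperm /= gx.
have inj_slice : {in orbitals G &, injective slice}.
  move=> D E OD OE eDE; have /card_gt0P[y] := subdegree_gt0 x OD; rewrite inE => Dxy.
  apply: (orbital_eqE OD OE Dxy); have : y \in slice D by rewrite inE.
  by rewrite eDE inE.
have -> : subdegrees G x = [seq #|(B : {set T})| | B <- enum (suborbits G x)] by [].
have enumE : perm_eq (enum (suborbits G x)) [seq slice D | D <- enum (orbitals G)].
  apply: uniq_perm; rewrite ?enum_uniq ?map_inj_in_uniq ?enum_uniq //.
    by move=> D E; rewrite !mem_enum; apply: inj_slice.
  move=> B; rewrite mem_enum Dsub; apply/imsetP/mapP => [] [D OD ->]; exists D => //.
    by rewrite mem_enum.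
  by rewrite mem_enum in OD.
apply: perm_trans (perm_map _ enumE) _; rewrite -map_comp.
have -> : [:: 1%N; subdegree D1 x; subdegree D2 x; subdegree D3 x] =
    [seq subdegree D x | D <- [:: diagonal T; D1; D2; D3]].
  by rewrite /= subdegree_diagonal.
apply: perm_map; apply: uniq_perm; rewrite ?enum_uniq // => D.
by rewrite mem_enum OG !inE -!orbA.
Qed.

End Labelled.

(** The rank is 4, so the diagonal and the two given orbitals leave exactly one. *)
Lemma exists_labelling D2 D3 : nontrivial_orbital G D2 -> nontrivial_orbital G D3 ->
  D2 != D3 -> exists D1, uniq [:: diagonal T; D1; D2; D3] /\
    orbitals G = [set diagonal T; D1; D2; D3].
Proof.
move=> /andP[O2 n2] /andP[O3 n3] n23.
have /card_gt0P[x _] : (0 < #|T|)%N by rewrite cardT muln_gt0 (leq_trans _ p_ge5).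
have Od := diagonal_in_orbitals primG x.
have := typeIV_rank p_ge5 IV.
rewrite (cardsD1 (diagonal T)) Od (cardsD1 D2) (cardsD1 D3) !in_setD1 n2 O2 n3 O3 eq_sym n23.
move=> [] /eqP /cards1P[D1 DD1]; exists D1.
have : D1 \in [set D1] by rewrite inE.
rewrite -DD1 !in_setD1 => /and4P[n13 n12 n1 O1]; split.
  by rewrite /= !inE !negb_or ![diagonal T == _]eq_sym n1 n2 n3 n12 n13 n23.
apply/setP=> D; have := DD1 => /setP/(_ D); rewrite !(in_setD1, in_set1, in_setU).
have [->|_] := eqVneq D D3; first by rewrite O3 !orbT.
have [->|_] := eqVneq D D2; first by rewrite O2 !orbT.
by have [->|_] := eqVneq D (diagonal T); rewrite ?Od //= => ->; rewrite !orbF.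
Qed.

End Labelling.

Theorem theorem9p2 (p : nat) (T : finType) (G : {group {perm T}}) :
  prime p -> (5 <= p)%N -> #|T| = (3 * p)%N ->
  [primitive G, on [set: T] | 'P] ->
  ~~ [transitive^2 G, on [set: T] | 'P] ->
  typeIV G p ->
  exists a : int,
    [/\ p%:Z = 3 * a ^+ 2 + 3 * a + 1,
        #|orbitals G| = 4%N
      & forall (x : T) (D1 D2 D3 : {set T * T}),
          uniq [:: diagonal T; D1; D2; D3] ->
          orbitals G = [set diagonal T; D1; D2; D3] ->
          (paired D2 = D3 ->
             [/\ (2 %| a)%Z,
                 (subdegree D1 x)%:Z = p%:Z - 2 * a - 1,
                 (subdegree D2 x)%:Z = p%:Z + a
               & (subdegree D3 x)%:Z = p%:Z + a]
             \/
             [/\ ~~ (2 %| a)%Z,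
                 (subdegree D1 x)%:Z = p%:Z + 2 * a + 1,
                 (subdegree D2 x)%:Z = p%:Z - a - 1
               & (subdegree D3 x)%:Z = p%:Z - a - 1])
          /\
          (~ (exists D E : {set T * T},
                [/\ D \in orbitals G, E \in orbitals G, D != E
                  & paired D = E]) ->
             [/\ forall D, D \in orbitals G -> paired D = D,
                 (2 %| a)%Z
               & perm_eq [seq n%:Z | n <- subdegrees G x]
                   [:: 1; p%:Z + 2 * a + 1; p%:Z - a - 1; p%:Z - a - 1]])].
Proof.
move=> pr_p p_ge5 cardT primG _ IV.
have /card_gt0P[x0 _] : (0 < #|T|)%N by rewrite cardT muln_gt0 (leq_trans _ p_ge5).
have Od := diagonal_in_orbitals primG x0.
have pairedD : paired (diagonal T) = diagonal T.
  by apply/setP=> -[y z]; rewrite paired_mem !diagonalE eq_sym.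
have [/exists_inP[D2 O2 nP2]|allP] :=
    boolP [exists D in orbitals G, paired D != D].
  have n2 : D2 != diagonal T by apply: contraNneq nP2 => ->; rewrite pairedD.
  have O3 := paired_orbital O2.
  have n3 : paired D2 != diagonal T.
    by apply: contraNneq n2 => e; rewrite -(pairedK D2) e pairedD.
  have [D1 [Unq OG]] := exists_labelling p_ge5 cardT primG IV
    (introT andP (conj O2 n2)) (introT andP (conj O3 n3)) ltac:(by rewrite eq_sym).
  have [a [a2 Dp _ _ _]] := labelled_paired p_ge5 cardT primG IV x0 Unq OG (erefl _).
  exists a; split=> //; first exact: typeIV_rank p_ge5 IV.
  move=> x E1 E2 E3 UE OE; split=> [P23|[]]; last first.
    by exists D2, (paired D2); rewrite eq_sym.
  (* Alternatives (i) and (ii) are exchanged by [a -> - 1 - a]; the odd representative puts every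
     labelling in the second. *)
  right; have [b [b2 Dp' e1 e2 e3]] := labelled_paired p_ge5 cardT primG IV x UE OE P23.
  have -> // : a = b.
  by apply: centred_hex_inj; rewrite -?Dp -?Dp' // (negPf a2) (negPf b2).
have selfP D : D \in orbitals G -> paired D = D.
  by move=> OD; apply/eqP; apply: contraR allP => nP; apply/exists_inP; exists D.
have [D2 [D3 [N2 N3 n23]]] : exists D2 D3,
    [/\ nontrivial_orbital G D2, nontrivial_orbital G D3 & D2 != D3].
  have : (1 < #|orbitals G :\ diagonal T|)%N.
    by have := cardsD1 (diagonal T) (orbitals G); rewrite (typeIV_rank p_ge5 IV) Od add1n => -[<-].
  case/card_gt1P=> D2 [D3 []]; rewrite !in_setD1 => /andP[n2 O2] /andP[n3 O3] n23.
  by exists D2, D3; rewrite /nontrivial_orbital O2 O3.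
have selfL x E1 E2 E3 (UE : uniq [:: diagonal T; E1; E2; E3])
    (OE : orbitals G = [set diagonal T; E1; E2; E3]) :=
  labelled_selfpaired pr_p p_ge5 cardT primG IV x UE OE.
have [D1 [Unq OG]] := exists_labelling p_ge5 cardT primG IV N2 N3 n23.
have [|||a [a2 Dp _]] := selfL x0 _ _ _ Unq OG;
  try by apply: selfP; rewrite OG !inE eqxx ?orbT.
exists a; split=> //; first exact: typeIV_rank p_ge5 IV.
move=> x E1 E2 E3 UE OE; split=> [P23|_].
  have E23 : E2 = E3 by rewrite -P23 selfP // OE !inE eqxx ?orbT.
  by move: UE; rewrite E23 /= !inE eqxx !andbF.
split=> //.
have [|||b [b2 Dp' Eb]] := selfL x _ _ _ UE OE;
  try by apply: selfP; rewrite OE !inE eqxx ?orbT.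
(* Every labelling yields an even solution, so the [a] found at [x0] serves for all points and
   labellings. *)
have -> : a = b by apply: centred_hex_inj; rewrite -?Dp -?Dp' // a2 b2.
apply: perm_trans (perm_map _ (subdegrees_labelled primG x UE OE)) _.
(* The three cases differ only in the position of the exceptional subdegree [A]. *)
rewrite /= perm_cons; set A := _ + 1; set B := _ - 1 in Eb *.
case: Eb => [[-> -> ->]|[-> -> ->]|[-> -> ->]] //.
  exact: (permEl (perm_catCA [:: B] [:: A] [:: B])).
by rewrite -[[:: A; B; B]]/([:: A] ++ [:: B; B]) perm_sym perm_catC.
Qed.
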